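(* Let $S$ be a Seidel matrix of order $n\geqslant277$ with $\lambda_{\min}(S)=-5$ and $\omega([S])=4$. If $\alpha([S])\geqslant29$, then $\operatorname{rk}(S+5\mathbf{I})\geqslant\frac{2n}{3}+1$.
   Context: All graphs are finite, simple, undirected. A Seidel matrix of order $n$ is a real symmetric $n\times n$ matrix with zero diagonal and off-diagonal entries in $\{\pm1\}$; its graph $G(S)$ has vertex set $\{1,\dots,n\}$ with $i\sim j$ iff $S_{ij}=-1$. The switching graph $\mathcal{Sw}(S)$ is the graph $G(S')$ of the Seidel matrix $S'=\begin{pmatrix}S&-S+\mathbf{I}\\-S+\mathbf{I}&S\end{pmatrix}$ of order $2n$. Define $\alpha([S]):=\alpha(\mathcal{Sw}(S))$ (independence number) and $\omega([S]):=\omega(\mathcal{Sw}(S))$ (clique number). $\lambda_{\min}$ is the smallest eigenvalue, $\operatorname{rk}$ the rank. *)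

(* Defs.v *)
From mathcomp Require Import all_boot all_order all_algebra.
From mathcomp Require Import reals.

Set Implicit Arguments.
Unset Strict Implicit.
Unset Printing Implicit Defensive.

Import Order.TTheory GRing.Theory Num.Theory.
Local Open Scope ring_scope.

Section Graph.
Variables (T : finType) (e : rel T).

Definition clique (A : {set T}) : bool :=
  [forall x in A, forall y in A, (x != y) ==> e x y].

Definition independent (A : {set T}) : bool :=
  [forall x in A, forall y in A, ~~ e x y].

Definition clique_number : nat := (\max_(A : {set T} | clique A) #|A|)%N.

Definition independence_number : nat :=
  (\max_(A : {set T} | independent A) #|A|)%N.

End Graph.

Section Seidel.
Variable R : realType.

Definition seidel (n : nat) (S : 'M[R]_n) : Prop :=
  [/\ S^T = S,
      forall i, S i i = 0
    & forall i j, i != j -> S i j = 1 \/ S i j = -1].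

Definition seidel_graph (n : nat) (S : 'M[R]_n) : rel 'I_n :=
  fun i j => S i j == -1.

Definition switching_mx (n : nat) (S : 'M[R]_n) : 'M[R]_(n + n) :=
  block_mx S (- S + 1%:M) (- S + 1%:M) S.

Definition switching_graph (n : nat) (S : 'M[R]_n) : rel 'I_(n + n) :=
  seidel_graph (switching_mx S).

Definition switching_alpha (n : nat) (S : 'M[R]_n) : nat :=
  independence_number (switching_graph S).

Definition switching_omega (n : nat) (S : 'M[R]_n) : nat :=
  clique_number (switching_graph S).

(* Only eigenvalues in R are compared; for symmetric S these are all of them. *)
Definition is_lambda_min (n : nat) (S : 'M[R]_n) (a : R) : Prop :=
  eigenvalue S a /\ (forall b : R, eigenvalue S b -> a <= b).

Lemma seidel_graph_sym (n : nat) (S : 'M[R]_n) :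
  seidel S -> symmetric (seidel_graph S).
Proof. by case=> symS _ _ i j; rewrite /seidel_graph -{1}symS mxE. Qed.

Lemma seidel_graph_irr (n : nat) (S : 'M[R]_n) :
  seidel S -> irreflexive (seidel_graph S).
Proof.
by case=> _ S0 _ i; rewrite /seidel_graph S0 eq_sym oppr_eq0 oner_eq0.
Qed.

Lemma switching_mx_seidel (n : nat) (S : 'M[R]_n) :
  seidel S -> seidel (switching_mx S).
Proof.
case=> symS S0 S1; split.
- by rewrite /switching_mx tr_block_mx linearD linearN /= symS trmx1.
- by move=> i; rewrite -(splitK i); case: (split i) => k /=;
    rewrite ?block_mxEul ?block_mxEdr.
have offd (k l : 'I_n) : (- S + 1%:M) k l = 1 \/ (- S + 1%:M) k l = -1.
  rewrite !mxE; have [->|kl] := eqVneq k l; first by left; rewrite S0 oppr0 add0r.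
  by case: (S1 _ _ kl) => ->; rewrite addr0 ?opprK; [right | left].
move=> i j; rewrite -(splitK i) -(splitK j).
case: (split i) => k; case: (split j) => l /= kl;
  rewrite ?block_mxEul ?block_mxEur ?block_mxEdl ?block_mxEdr //;
  apply: S1; apply: contraNneq kl => ->; exact: eqxx.
Qed.

End Seidel.

(* Main.v *)
Require Import Defs.
From mathcomp Require Import all_boot all_order all_algebra.
From mathcomp Require Import reals.
From mathcomp Require Import complex ring lra zify.

Set Implicit Arguments.
Unset Strict Implicit.
Unset Printing Implicit Defensive.

Import Order.TTheory GRing.Theory Num.Theory.
Local Open Scope ring_scope.

(** Switch [S] so that a maximum independent set [A] of the switching graph (at
least 29 vertices) is independent in the graph [e] of the switched matrix and
every vertex is joined to at most half of [A].  The switched [S + 5I] is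
[4I - 2E + J], with [E] the adjacency matrix of [e]; being positive semidefinite
it leaves [e] little room: every vertex has at most 5 neighbours in [A].
It suffices to find a set [Y] of at least [2n/3 + 1] vertices on which [2I - E]
is positive definite, since [S + 5I] has rank at least [#|Y|].

If [e] has a triangle, at most 33 vertices lie on it or touch it, and the
others are independent because [omega([S]) < 5].

Otherwise every degree is at most 32.  Balancing against [J] shows that when
[2I - E] takes a negative value at a nonnegative vector, it is positive definite
on the vertices not touching the support.  For a star with 5 leaves this
leaves a forest with at least 85 vertices, hence 41 independent ones, too many;
so all degrees are at most 4.  If a negative vector is supported on at most 15
vertices, the vertices not touching the support form a suitable [Y].  If there
is none, a connected set of 10 vertices has at most 4 neighbours outside
(test with the vector worth 2 inside and 1 on 5 outside neighbours).  Repeatedly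
keeping such a set and discarding its neighbours, or discarding one vertex of a
component with 4 to 10 vertices, keeps at least 10/14 of all vertices. *)

(** * Rayleigh quotients of real symmetric matrices *)

Section Rayleigh.
Local Open Scope sesquilinear_scope.

Lemma eigenvalue_map_complex (R : rcfType) n (S : 'M[R]_n) (b : R) :
  eigenvalue (map_mx (real_complex R) S) b%:C%C = eigenvalue S b.
Proof. by rewrite !eigenvalue_root_char -map_char_poly fmorph_root. Qed.

(** A unitary diagonalisation over the complex extension turns both sides into sums of the
    [w_i w_i^*], weighted on the right by the spectral values. These are real, and they are
    eigenvalues of [S] over [R] because the characteristic polynomial is the same. *)
Lemma rayleigh_ge (R : rcfType) n (S : 'M[R]_n) (a : R) (u : 'rV[R]_n) :
    S^T = S -> (forall b, eigenvalue S b -> a <= b) ->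
  a * (u *m u^T) 0 0 <= (u *m S *m u^T) 0 0.
Proof.
move=> symS le_a; pose c := real_complex R; pose A := map_mx c S.
have cJ (x : R) : Num.conj (c x) = c x by apply: conjc_real.
have Aherm : A \is hermsymmx.
  apply: realsym_hermsym.
    by apply/is_hermitianmxP; rewrite expr0 scale1r map_mx_id // map_trmx symS.
  by apply/mxOverP => i j; rewrite mxE; apply/complex_realP; exists (S i j).
have /orthomx_spectralP A_eq := hermitian_normalmx Aherm.
have Dreal := hermitian_spectral_diag_real Aherm.
set P := spectralmx A in A_eq; set D := spectral_diag A in A_eq Dreal.
have Punit : P \is unitarymx := spectral_unitarymx A.
have Pu : P \in unitmx := spectral_unit A.
pose v := map_mx c u.
have [w wE] : exists w, w = v *m P^t* by exists (v *m P^t*).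
have vJ : v^t* = map_mx c u^T by apply/matrixP=> i j; rewrite !mxE cJ.
have wJ : w^t* = P *m v^t*.
  by rewrite wE trmx_mul map_mxM trmxCK.
have eS : c ((u *m S *m u^T) 0 0) = \sum_i D 0 i * (w 0 i * (w 0 i)^*).
  transitivity ((w *m diag_mx D *m w^t*) 0 0).
    rewrite wJ wE -(invmx_unitary Punit) !mulmxA -[_ *m diag_mx D *m P]mulmxA.
    rewrite -[_ *m _ *m (diag_mx D *m P)]mulmxA [X in v *m X]mulmxA -A_eq vJ.
    by rewrite -!map_mxM [RHS]mxE.
  rewrite mxE; apply: eq_bigr => i _; rewrite mul_mx_diag.
  by rewrite !mxE [w 0 i * D 0 i]mulrC mulrA.
have e1 : c ((u *m u^T) 0 0) = \sum_i w 0 i * (w 0 i)^*.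
  transitivity ((w *m w^t*) 0 0).
    by rewrite wJ wE mulmxA mulmxKtV // vJ -map_mxM [RHS]mxE.
  by rewrite mxE; apply: eq_bigr => i _; rewrite !mxE.
have cM (x y : R) : c (x * y) = c x * c y by apply: (rmorphM (real_complex R)).
rewrite -lecR -/c cM eS e1 mulr_sumr; apply: ler_sum => i _.
apply: ler_wpM2r; first exact: mul_conjC_ge0.
have /mxOverP/(_ 0 i)/complex_realP[d dE] := Dreal.
rewrite dE lecR; apply: le_a; rewrite -eigenvalue_map_complex -dE -/c -/A.
(* The rows of the unitary matrix are eigenvectors, nonzero because it is invertible. *)
apply/eigenvalueP; exists (row i P).
  rewrite A_eq -row_mul !mulmxA mulmxV // mul1mx row_mul row_diag_mx.
  by rewrite -scalemxAl -rowE.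
apply: contraTneq Pu => rP0; rewrite -row_free_unit; apply/negP => /row_freeP[B PB].
have /matrixP/(_ 0 i) : row i P *m B = row i 1%:M by rewrite -row_mul PB.
by rewrite rP0 mul0mx !mxE eqxx => /eqP; rewrite eq_sym oner_eq0.
Qed.

End Rayleigh.

(** * The quadratic forms of a graph, tested on weighted vertex classes *)

Section Forms.
Variables (R : realFieldType) (T : finType) (e : rel T).
Hypotheses (e_sym : symmetric e) (e_irr : irreflexive e).
Implicit Types (f g : T -> R) (P Q : {set T}) (x : T).

Definition nbr x Q : {set T} := [set j in Q | e x j].

(** This counts ordered pairs, so [edges P P] is twice the number of edges inside [P]. *)
Definition edges P Q : nat := (\sum_(i in P) #|nbr i Q|)%N.

Definition pform f g : R :=
  2 * (\sum_i f i * g i) - \sum_i \sum_j (e i j)%:R * (f i * g j).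

(* The bilinear form of [4I - 2E + J], where [pform] is that of [2I - E]. *)
Definition qform f g : R := 2 * pform f g + (\sum_i f i) * (\sum_i g i).

Definition ind P : T -> R := fun i => (i \in P)%:R.

Lemma eq_pform f f' g g' : f =1 f' -> g =1 g' -> pform f g = pform f' g'.
Proof.
move=> ff gg; congr (_ * _ - _); first by apply: eq_bigr => i _; rewrite ff gg.
by apply: eq_bigr => i _; apply: eq_bigr => j _; rewrite ff gg.
Qed.

Lemma pformC f g : pform f g = pform g f.
Proof.
congr (_ * _ - _); first by apply: eq_bigr => i _; rewrite mulrC.
rewrite exchange_big; apply: eq_bigr => i _; apply: eq_bigr => j _ /=.
by rewrite e_sym [f _ * _]mulrC.
Qed.

Lemma pform_sumr f (I : Type) (r : seq I) (c : I -> R) (G : I -> T -> R) :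
  pform f (fun i => \sum_(k <- r) c k * G k i)
  = \sum_(k <- r) c k * pform f (G k).
Proof.
rewrite /pform.
under [X in 2 * X]eq_bigr do rewrite mulr_sumr.
under [X in _ - X]eq_bigr do
  under eq_bigr do rewrite mulr_sumr mulr_sumr.
rewrite exchange_big /=.
under [X in _ - X]eq_bigr do rewrite exchange_big /=.
rewrite [X in _ - X]exchange_big /= mulr_sumr -sumrB; apply: eq_bigr => k _.
rewrite mulrBr; congr (_ - _).
  by rewrite mulrCA !mulr_sumr; apply: eq_bigr => i _; ring.
rewrite mulr_sumr; apply: eq_bigr => i _; rewrite mulr_sumr.
by apply: eq_bigr => j _; ring.
Qed.

Lemma pform_suml g (I : Type) (r : seq I) (c : I -> R) (F : I -> T -> R) :
  pform (fun i => \sum_(k <- r) c k * F k i) g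
  = \sum_(k <- r) c k * pform (F k) g.
Proof.
by rewrite pformC pform_sumr; apply: eq_bigr => k _; rewrite pformC.
Qed.

Lemma pform_comb (a b : R) f g :
  pform (fun i => a * f i + b * g i) (fun i => a * f i + b * g i)
  = a ^+ 2 * pform f f + 2 * a * b * pform f g + b ^+ 2 * pform g g.
Proof.
pose F (k : bool) := if k then f else g; pose c (k : bool) := if k then a else b.
have E : (fun i => a * f i + b * g i)
    =1 (fun i => \sum_(k <- [:: true; false]) c k * F k i).
  by move=> i; rewrite !big_cons big_nil addr0.
rewrite (eq_pform E E) pform_suml !big_cons big_nil /= !pform_sumr.
by rewrite !big_cons !big_nil /= (pformC g f); ring.
Qed.

Lemma sum_ind P g : \sum_i ind P i * g i = \sum_(i in P) g i.
Proof.
by rewrite [RHS]big_mkcond; apply: eq_bigr => i _; rewrite /ind;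
  case: ifP; rewrite ?mul1r ?mul0r.
Qed.

Lemma sum_ind1 P : \sum_i ind P i = #|P|%:R.
Proof.
rewrite -sum1_card natr_sum [RHS]big_mkcond; apply: eq_bigr => i _.
by rewrite /ind; case: ifP.
Qed.

Lemma pform_ind P Q : pform (ind P) (ind Q) = 2 * #|P :&: Q|%:R - (edges P Q)%:R.
Proof.
congr (_ * _ - _).
  rewrite -sum_ind1; apply: eq_bigr => i _; rewrite /ind inE -natrM.
  by case: (i \in P); case: (i \in Q).
rewrite /edges natr_sum -sum_ind; apply: eq_bigr => i _.
rewrite -sum_ind1 mulr_sumr; apply: eq_bigr => j _; rewrite /ind inE.
by case: (i \in P); case: (j \in Q); case: (e i j); rewrite /= ?(mulr0, mul0r, mulr1).
Qed.

Lemma edgesC P Q : edges P Q = edges Q P.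
Proof.
have := pformC (ind P) (ind Q); rewrite !pform_ind setIC => /addrI/oppr_inj/eqP.
by rewrite eqr_nat => /eqP.
Qed.

Lemma edges1 x Q : edges [set x] Q = #|nbr x Q|.
Proof. by rewrite /edges big_set1. Qed.

Fixpoint cross (s : seq (R * {set T})) : R :=
  if s is p :: s' then
    p.1 * (\sum_(q <- s') q.1 * (edges p.2 q.2)%:R) + cross s'
  else 0.

Definition comb (s : seq (R * {set T})) : T -> R :=
  fun i => \sum_(p <- s) p.1 * ind p.2 i.

Lemma pform_cons p s f :
  pform (comb (p :: s)) f = p.1 * pform (ind p.2) f + pform (comb s) f.
Proof. by rewrite !pform_suml big_cons. Qed.

(** Distinct classes share no diagonal term, so only class sizes and edge counts remain; every test
    vector below thus becomes a numerical inequality. *)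
Lemma pform_comb_disjoint s :
  pairwise (fun p q : R * {set T} => [disjoint p.2 & q.2]) s ->
  pform (comb s) (comb s)
  = \sum_(p <- s) p.1 ^+ 2 * (2 * #|p.2|%:R - (edges p.2 p.2)%:R) - 2 * cross s.
Proof.
elim: s => [_|p s IH /=/andP[ps dis]].
  have z i : comb [::] i = 0 by rewrite /comb big_nil.
  rewrite big_nil /= mulr0 subr0 /pform big1 => [|i _]; last by rewrite z mul0r.
  rewrite big1 => [|i _]; last by rewrite big1 // => j _; rewrite z mul0r mulr0.
  by rewrite mulr0 subr0.
have E : pform (comb s) (ind p.2) = - (\sum_(q <- s) q.1 * (edges p.2 q.2)%:R).
  rewrite pform_suml -sumrN big_seq [RHS]big_seq; apply: eq_bigr => q qs.
  rewrite pform_ind setIC; have /allP/(_ q qs)/disjoint_setI0-> := ps.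
  by rewrite cards0 edgesC; ring.
rewrite pform_cons !(pformC _ (comb (p :: s))) !pform_cons IH //.
by rewrite big_cons pform_ind setIid (pformC (ind _)) E; ring.
Qed.

Lemma sum_comb s : \sum_i comb s i = \sum_(p <- s) p.1 * #|p.2|%:R.
Proof.
rewrite exchange_big; apply: eq_bigr => p _ /=.
by rewrite -mulr_sumr sum_ind1.
Qed.

Lemma edges0 P Q : {in P & Q, forall x y, ~~ e x y} -> edges P Q = 0%N.
Proof.
move=> PQ; apply: big1 => x xP; apply: eq_card0 => y; rewrite !inE.
by apply/negP => /andP[yQ]; apply/negP/PQ.
Qed.

Lemma edges_full P Q : {in P & Q, forall x y, e x y} -> edges P Q = (#|P| * #|Q|)%N.
Proof.
move=> PQ; rewrite /edges -sum_nat_const; apply: eq_bigr => x xP.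
by apply: eq_card => y; rewrite !inE; case: (boolP (y \in Q)) => //= /(PQ _ _ xP).
Qed.

Lemma edges_le P Q c : {in P, forall x, (#|nbr x Q| <= c)%N} ->
  (edges P Q <= #|P| * c)%N.
Proof. by move=> PQ; rewrite -sum_nat_const; apply: leq_sum. Qed.

Lemma nbrS x P Q : P \subset Q -> nbr x P \subset nbr x Q.
Proof.
by move=> PQ; apply/subsetP => y; rewrite !inE => /andP[/(subsetP PQ)->].
Qed.

Lemma nbr_sub x Q : nbr x Q \subset Q.
Proof. by apply/subsetP => y; rewrite inE => /andP[]. Qed.

Lemma mem_nbr x Q y : (y \in nbr x Q) = (y \in Q) && e x y.
Proof. by rewrite inE. Qed.

Lemma exists_subset k (A : {set T}) : (k <= #|A|)%N ->
  exists2 B : {set T}, B \subset A & #|B| = k.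
Proof.
move=> kA; exists [set x in take k (enum A)].
  by apply/subsetP => x; rewrite inE => /mem_take; rewrite mem_enum.
rewrite cardsE (card_uniqP _) ?take_uniq ?enum_uniq // size_take -cardE.
by case: ltngtP kA.
Qed.

Lemma adj_neq x y : e x y -> x != y.
Proof. by apply: contraTneq => ->; rewrite e_irr. Qed.

Lemma edges11 x y : edges [set x] [set y] = e x y.
Proof.
rewrite edges1; case: (boolP (e x y)) => exy.
  by apply: etrans (cards1 y); apply: eq_card => z; rewrite !inE; case: eqP => // ->.
by apply: eq_card0 => z; rewrite !inE; case: eqP => //= ->; apply/negbTE.
Qed.

Lemma independentP (A : {set T}) :
  reflect {in A &, forall x y, ~~ e x y} (independent e A).
Proof.
apply: (iffP forall_inP) => [indA x y xA yA|indA x xA].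
  exact: (forall_inP (indA x xA)).
by apply/forall_inP => y yA; apply: indA.
Qed.

Lemma independentS (A B : {set T}) : A \subset B -> independent e B -> independent e A.
Proof.
by move=> /subsetP AB /independentP indB; apply/independentP => x y /AB ? /AB ?; apply: indB.
Qed.

Lemma edges_independent (A B C : {set T}) :
  independent e A -> B \subset A -> C \subset A -> edges B C = 0%N.
Proof.
move=> /independentP indA /subsetP BA /subsetP CA.
by apply: edges0 => x y /BA ? /CA ?; apply: indA.
Qed.

Lemma disjointDr (A B : {set T}) : [disjoint A & B :\: A].
Proof. by apply/pred0P => t /=; rewrite in_setD; case: (t \in A). Qed.

Lemma disjoint0r (A : {set T}) : [disjoint A & set0].
Proof. by apply/pred0P => t /=; rewrite in_set0 andbF. Qed.

Lemma cliqueP (P : {set T}) :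
  reflect {in P &, forall p q, p != q -> e p q} (clique e P).
Proof.
apply: (iffP forall_inP) => [clP p q pP qP|clP p pP].
  exact/implyP/(forall_inP (clP p pP)).
by apply/forall_inP => q qP; apply/implyP; apply: clP.
Qed.

Lemma clique2 p q : e p q -> clique e [set p; q].
Proof.
move=> pq; apply/cliqueP => i j /set2P[]-> /set2P[]->; rewrite ?eqxx // => _.
by rewrite e_sym.
Qed.

Lemma cliqueU1 p (P : {set T}) : clique e P -> {in P, forall q, e p q} -> clique e (p |: P).
Proof.
move=> /cliqueP clP pP; apply/cliqueP => i j /setU1P[->|iP] /setU1P[->|jP].
- by rewrite eqxx.
- by move=> _; apply: pP.
- by move=> _; rewrite e_sym; apply: pP.
- exact: clP.
Qed.

Section Semidefinite.
Hypothesis psd : forall f, 0 <= qform f f.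

(* Below, the numerical weights put on the classes are roundings of the vector
   minimising the form among those constant on every class. *)
Lemma class_test s :
  pairwise (fun p q : R * {set T} => [disjoint p.2 & q.2]) s ->
  0 <= 2 * (\sum_(p <- s) p.1 ^+ 2 * (2 * #|p.2|%:R - (edges p.2 p.2)%:R))
       - 4 * cross s + (\sum_(p <- s) p.1 * #|p.2|%:R) ^+ 2.
Proof.
move=> dis; have := psd (comb s).
rewrite /qform pform_comb_disjoint // sum_comb; congr (_ <= _); ring.
Qed.

(** With [k] and [r] the sizes of [N] and [O], the test vector below has value
    [4 (k + r + 4) (36 - (k - 4) (r - 4))], whose first factors are positive. *)
Lemma star_bound x (N O : {set T}) :
  x \notin O -> independent e (N :|: O) -> [disjoint N & O] ->
  {in N, forall y, e x y} -> {in O, forall y, ~~ e x y} ->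
  (#|N|%:R - 4) * (#|O|%:R - 4) <= 36 :> R.
Proof.
move=> xO ind_NO dis_NO xN_adj xO_nadj.
have indE y z : y \in N :|: O -> z \in N :|: O -> ~~ e y z.
  by move=> yNO zNO; move/forall_inP/(_ y yNO)/forall_inP/(_ z zNO): ind_NO.
set k := #|N|%:R; set r := #|O|%:R.
have eNN : edges N N = 0%N.
  by apply: edges0 => y z yN zN; apply: indE; rewrite inE ?yN ?zN.
have eNO : edges N O = 0%N.
  by apply: edges0 => y z yN zO; apply: indE; rewrite inE ?yN ?zO ?orbT.
have eOO : edges O O = 0%N.
  by apply: edges0 => y z yO zO; apply: indE; rewrite inE ?yO ?zO ?orbT.
have exx : edges [set x] [set x] = 0%N.
  by apply: edges0 => y z /set1P-> /set1P->; rewrite e_irr.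
have exN : edges [set x] N = #|N|.
  by rewrite edges_full ?cards1 ?mul1n // => y z /set1P-> /xN_adj.
have exO : edges [set x] O = 0%N.
  by rewrite edges0 // => y z /set1P-> /xO_nadj.
have := @class_test [:: (2 * (k + r + 4), [set x]); (r + 2, N); (- (k + 2), O)].
rewrite /= !disjoints1 xO dis_NO !andbT.
have -> : x \notin N by apply/negP => /xN_adj; rewrite e_irr.
move=> /(_ isT); rewrite !big_cons !big_nil /= eNN eNO eOO exx exN exO cards1.
rewrite -/k -/r => H.
have {}H : 0 <= (4 * (k + r + 4)) * (36 - (k - 4) * (r - 4)).
  by move: H; congr (_ <= _); ring.
have k0 : 0 <= k := ler0n _ _; have r0 : 0 <= r := ler0n _ _.
by move: H; rewrite pmulr_rge0 ?subr_ge0 //; lra.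
Qed.

End Semidefinite.
End Forms.

(** * Inequalities for the vertices around a triangle *)

Section Triangle.
Variables (R : realFieldType) (T : finType) (e : rel T).
Hypotheses (e_sym : symmetric e) (e_irr : irreflexive e).
Hypothesis psd : forall f : T -> R, 0 <= qform e f f.

Variables x y z : T.
Hypotheses (xy : e x y) (xz : e x z) (yz : e y z).

(** For [2 < r < 18] the test vector has value at most [128 (r - 2) (r - 18) < 0]: the triangle
    alone contributes nothing to [2I - E], and each touched vertex has at least one edge to it. *)
Lemma triangle_nbrs (B N : {set T}) :
  independent e B -> #|B| = 28%N -> x \notin B -> y \notin B -> z \notin B ->
  N = [set b in B | [|| e x b, e y b | e z b]] ->
  (#|N| <= 2)%N || (18 <= #|N|)%N.
Proof.
move=> indB cB xB yB zB NE; set r := #|N|.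
have NB : N \subset B by rewrite NE; apply/subsetP => b; rewrite inE => /andP[].
have OB : B :\: N \subset B by rewrite subsetDl.
have cO : #|B :\: N|%:R = 28 - r%:R :> R.
  by rewrite -cB -(cardsID N B) (setIidPr NB) natrD addrC addKr.
have notin t : t \notin B -> (t \notin N) && (t \notin B :\: N).
  by move=> tB; rewrite (contra (subsetP NB t)) // inE (negbTE tB) andbF.
have /andP[xN xO] := notin _ xB; have /andP[yN yO] := notin _ yB.
have /andP[zN zO] := notin _ zB.
have Ofar t : [|| t == x, t == y | t == z] -> edges e [set t] (B :\: N) = 0%N.
  move=> txyz; apply: edges0 => ? b /set1P->; rewrite in_setD => /andP[bN bB].
  move: bN; rewrite NE inE bB /= !negb_or => /and3P[? ? ?].
  by case/or3P: txyz => /eqP->.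
have le_r : r%:R <= #|nbr e x N|%:R + #|nbr e y N|%:R + #|nbr e z N|%:R :> R.
  rewrite -!natrD ler_nat.
  apply: leq_trans (leq_trans (leq_card_setU _ _) (leq_add (leq_card_setU _ _) (leqnn _))).
  apply/subset_leq_card/subsetP => b bN; rewrite !inE bN /=.
  by move: bN; rewrite NE inE => /andP[_]; rewrite orbA.
have := @class_test _ _ _ e_sym psd
  [:: (64, [set x]); (64, [set y]); (64, [set z]); (26 - r%:R, N); (- (r%:R + 6), B :\: N)].
rewrite /= !disjoints1 !in_set1 (adj_neq e_irr xy) (adj_neq e_irr xz) (adj_neq e_irr yz).
rewrite disjointDr xN xO yN yO zN zO !andbT => /(_ isT).
rewrite !big_cons !big_nil /= !edges11 xy xz yz !e_irr !Ofar ?eqxx ?orbT //.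
rewrite !edges1 !cards1 !(edges_independent indB) // cO -/r.
move=> H; apply: contraT; rewrite negb_or -!ltnNge => /andP[r2 r18].
have r2' : 3 <= r%:R :> R by rewrite ler_nat.
have r18' : r%:R <= 17 :> R by rewrite ler_nat.
have h1 : 0 <= (26 - r%:R) *
    (#|nbr e x N|%:R + #|nbr e y N|%:R + #|nbr e z N|%:R - r%:R) :> R.
  by apply: mulr_ge0; lra.
have h2 : 0 < (r%:R - 2) * (18 - r%:R) :> R by apply: mulr_gt0; lra.
suff: 0 < 0 :> R by rewrite ltxx.
by move: H => /= H; lra.
Qed.

Definition far_from_triangle (U : {set T}) : Prop :=
  {in U, forall t, [&& t != x, t != y, t != z, ~~ e x t, ~~ e y t & ~~ e z t]}.

(** The instance of [class_test] shared by the next three bounds. Since [U] and [V] are independent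
    and far from the triangle, their only edges go to [W]. *)
Lemma triangle_test (W U V : {set T}) (a b c d f g : R) :
  far_from_triangle (U :|: V) -> independent e (U :|: V) ->
  [disjoint W & U] -> [disjoint W & V] -> [disjoint U & V] ->
  x \notin W -> y \notin W -> z \notin W ->
  0 <= 4 * (a ^+ 2 + b ^+ 2 + c ^+ 2 - a * b - a * c - b * c)
    + d ^+ 2 * (4 * #|W|%:R - 2 * (edges e W W)%:R)
    + 4 * f ^+ 2 * #|U|%:R + 4 * g ^+ 2 * #|V|%:R
    - 4 * d * (a * (edges e [set x] W)%:R + b * (edges e [set y] W)%:R
       + c * (edges e [set z] W)%:R + f * (edges e W U)%:R + g * (edges e W V)%:R)
    + (a + b + c + d * #|W|%:R + f * #|U|%:R + g * #|V|%:R) ^+ 2.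
Proof.
move=> far indUV WU WV UV xW yW zW.
have US := subsetUl U V; have VS := subsetUr U V.
have farE t : [|| t == x, t == y | t == z] ->
    [&& t \notin U, t \notin V, edges e [set t] U == 0%N & edges e [set t] V == 0%N].
  move=> txyz; have tUV : t \notin U :|: V.
    apply/negP => /far/and4P[tx ty tz _].
    by move: txyz; rewrite (negbTE tx) (negbTE ty) (negbTE tz).
  have far0 (X : {set T}) : X \subset U :|: V -> edges e [set t] X == 0%N.
    move=> /subsetP XS; apply/eqP/edges0 => _ r /set1P-> /XS/far/and5P[_ _ _ xr /andP[yr zr]].
    by case/or3P: txyz => /eqP->.
  by move: tUV; rewrite inE negb_or => /andP[-> ->]; rewrite !far0.
have /and4P[xU xV /eqP xU0 /eqP xV0] := farE x ltac:(by rewrite eqxx).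
have /and4P[yU yV /eqP yU0 /eqP yV0] := farE y ltac:(by rewrite eqxx orbT).
have /and4P[zU zV /eqP zU0 /eqP zV0] := farE z ltac:(by rewrite eqxx !orbT).
have := @class_test _ _ _ e_sym psd
  [:: (a, [set x]); (b, [set y]); (c, [set z]); (d, W); (f, U); (g, V)].
rewrite /= !disjoints1 !in_set1 (adj_neq e_irr xy) (adj_neq e_irr xz) (adj_neq e_irr yz).
rewrite xW yW zW xU yU zU xV yV zV WU WV UV => /(_ isT).
rewrite !big_cons !big_nil /= !edges11 xy xz yz !e_irr !cards1.
have UU : edges e U U = 0%N by apply: edges_independent indUV _ _.
have UV0 : edges e U V = 0%N by apply: edges_independent indUV _ _.
have VV : edges e V V = 0%N by apply: edges_independent indUV _ _.
rewrite xU0 xV0 yU0 yV0 zU0 zV0 UU UV0 VV.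
by congr (_ <= _); rewrite /=; ring.
Qed.

(** If [u] has [j] neighbours in [U], the test vector has value [16 j - 100], negative for
    [j <= 5]. *)
Lemma two_nbrs_bound (u : T) (U : {set T}) :
  e x u -> e y u -> ~~ e z u -> u != z -> far_from_triangle U ->
  independent e U -> #|U| = 26%N -> (6 <= #|nbr e u U|)%N.
Proof.
move=> xu yu zu uz farU indU cU; rewrite leqNgt; apply/negP; rewrite ltnS => j5.
have uU : u \notin U.
  by apply/negP => /farU; rewrite xu !andbF.
have := @triangle_test [set u] U set0 9 9 8 4 (-1) 0.
rewrite setU0 !disjoints1 !disjoint0r !in_set1 !in_set0.
rewrite (adj_neq e_irr xu) (adj_neq e_irr yu) eq_sym uz => /(_ farU indU uU isT isT isT isT isT).
rewrite !edges11 e_irr xu yu (negbTE zu) !edges1 cards1 cards0 cU.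
have: #|nbr e u U|%:R <= 5 :> R by rewrite ler_nat.
move=> j5' /= H; suff: 0 < 0 :> R by rewrite ltxx.
lra.
Qed.

(** With exactly five neighbours in [U], weighting these apart from the other 21 vertices of [U]
    gives the value -3. *)
Lemma one_nbr_bound (u : T) (U : {set T}) :
  e x u -> ~~ e y u -> ~~ e z u -> u != y -> u != z -> far_from_triangle U ->
  independent e U -> #|U| = 26%N -> #|nbr e u U| != 5%N.
Proof.
move=> xu yu zu uy uz farU indU cU; apply/negP => /eqP j5.
have uU : u \notin U.
  by apply/negP => /farU; rewrite xu !andbF.
set N := nbr e u U in j5.
have NU : N :|: (U :\: N) = U by rewrite -[RHS](setID U N) (setIidPr (nbr_sub e u U)).
have cO : #|U :\: N| = 21%N.
  have NsU : N \subset U := nbr_sub e u U.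
  by apply/eqP; rewrite -(eqn_add2l 5) -{1}j5 -{1}(setIidPr NsU) cardsID cU.
have := @triangle_test [set u] N (U :\: N) 4 2 2 6 2 (-1).
rewrite NU !disjoints1 !in_set1 disjointDr.
have -> : u \notin N by rewrite inE (negbTE uU).
have -> : u \notin U :\: N by rewrite inE (negbTE uU) andbF.
rewrite (adj_neq e_irr xu) eq_sym uy eq_sym uz => /(_ farU indU isT isT isT isT isT isT).
have -> : edges e [set u] N = 5%N.
  rewrite edges1 -[RHS]j5; apply: eq_card => t.
  by rewrite /N !inE; case: (t \in U); case: (e u t).
have -> : edges e [set u] (U :\: N) = 0%N.
  by apply: edges0 => _ t /set1P->; rewrite in_setD /N inE => /andP[+ tU]; rewrite tU.
rewrite !edges11 e_irr xu (negbTE yu) (negbTE zu) j5 cO cards1 /= => H.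
suff: 0 < 0 :> R by rewrite ltxx.
by lra.
Qed.

(** Eleven such vertices send at most 44 edges to [U], and then the test vector has value at most
    -12; edges inside [W] only lower it. *)
Lemma one_nbr_card (W U : {set T}) :
  {in W, forall u, [&& e x u, ~~ e y u & ~~ e z u]} -> y \notin W -> z \notin W ->
  far_from_triangle U -> independent e U -> #|U| = 26%N ->
  {in W, forall u, (#|nbr e u U| <= 4)%N} -> #|W| != 11%N.
Proof.
move=> adjW yW zW farU indU cU le4; apply/negP => /eqP cW.
have xW : x \notin W by apply/negP => /adjW; rewrite e_irr.
have WU : [disjoint W & U].
  apply/pred0P => t /=; apply/negP => /andP[/adjW/andP[xt _] /farU].
  by rewrite xt !andbF.
have := @triangle_test W U set0 20 12 12 2 (-2) 0.
rewrite setU0 !disjoint0r => /(_ farU indU WU isT isT xW yW zW).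
have -> : edges e [set x] W = 11%N.
  by rewrite edges_full ?cards1 ?mul1n // => _ t /set1P-> /adjW/andP[].
have -> : edges e [set y] W = 0%N.
  by apply: edges0 => _ t /set1P-> /adjW/and3P[].
have -> : edges e [set z] W = 0%N.
  by apply: edges0 => _ t /set1P-> /adjW/and3P[].
have: (edges e W U)%:R <= 44 :> R by rewrite ler_nat -[44%N]/(11 * 4)%N -cW edges_le.
have: 0 <= (edges e W W)%:R :> R by apply: ler0n.
rewrite cW cU cards0 => h1 h2 /= H.
suff: 0 < 0 :> R by rewrite ltxx.
by lra.
Qed.

End Triangle.

(** * The vertices away from a triangle *)

Section TriangleFar.
Variables (R : realFieldType) (T : finType) (e : rel T).
Hypotheses (e_sym : symmetric e) (e_irr : irreflexive e).
Hypothesis psd : forall f : T -> R, 0 <= qform e f f.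

(** Exactly five neighbours in [U] are excluded by [one_nbr_bound], so each of these vertices has at
    most four, and [one_nbr_card] rules out eleven of them. *)
Lemma card_one_nbr (x y z : T) (U : {set T}) :
  e x y -> e x z -> e y z -> far_from_triangle e x y z U ->
  independent e U -> #|U| = 26%N -> (forall u, (#|nbr e u U| <= 5)%N) ->
  (#|[set u | [&& e x u, ~~ e y u & ~~ e z u]]| <= 10)%N.
Proof.
move=> xy xz yz farU indU cU le5; rewrite leqNgt; apply/negP => /exists_subset[W].
move=> /subsetP WS cW; have adjW : {in W, forall u, [&& e x u, ~~ e y u & ~~ e z u]}.
  by move=> u /WS; rewrite inE.
have yW : y \notin W by apply/negP => /adjW; rewrite (e_sym z) yz !andbF.
have zW : z \notin W by apply/negP => /adjW; rewrite yz !andbF.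
have := one_nbr_card e_sym e_irr psd xy xz yz adjW yW zW farU indU cU.
rewrite cW => /(_ _)/negP; apply=> // u uW.
have /and3P[xu yu zu] := adjW u uW.
have uy : u != y by apply: contraNneq yW => <-.
have uz : u != z by apply: contraNneq zW => <-.
have := one_nbr_bound e_sym e_irr psd xy xz yz xu yu zu uy uz farU indU cU.
by have := le5 u; rewrite leq_eqVlt => /orP[/eqP->|].
Qed.

Variable A : {set T}.
Hypotheses (indA : independent e A) (cA : (29 <= #|A|)%N).
Hypothesis nbrA : forall u, (#|nbr e u A| <= 5)%N.
(** This is the form that [omega([S]) < 5] takes here: switching at [Q] would make the union of the
    two cliques a clique. *)
Hypothesis no_K5 : forall P Q : {set T}, clique e P -> clique e Q ->
  [disjoint P & Q] -> {in P & Q, forall p q, ~~ e p q} -> (#|P| + #|Q| <= 4)%N.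

(** The four vertices have at most 20 neighbours in [A] and at most 4 of them lie in [A], so some
    [a] in [A] remains; the clique and the singleton of [a] contradict [no_K5]. *)
Lemma no_K4 x y z u : e x y -> e x z -> e y z -> e x u -> e y u -> e z u -> False.
Proof.
move=> xy xz yz xu yu zu.
have clP : clique e (x |: (y |: [set z; u])).
  apply: (cliqueU1 e_sym); last by move=> q /setU1P[->|/set2P[]->].
  by apply: (cliqueU1 e_sym); [exact: (clique2 e_sym)|move=> q /set2P[]->].
set P := x |: _ in clP.
have cP : #|P| = 4%N.
  rewrite !cardsU1 cards1 !inE !negb_or (adj_neq e_irr xy) (adj_neq e_irr xz) (adj_neq e_irr xu).
  by rewrite (adj_neq e_irr yz) (adj_neq e_irr yu) (adj_neq e_irr zu).
have [a aA /and5P[ax ay az au aP]] : exists2 a, a \in A &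
    [&& ~~ e x a, ~~ e y a, ~~ e z a, ~~ e u a & a \notin P].
  pose D := nbr e x A :|: nbr e y A :|: nbr e z A :|: nbr e u A :|: (P :&: A).
  have cPA : (#|P :&: A| <= 4)%N by rewrite -cP subset_leq_card ?subsetIl.
  have cD : (#|D| < #|A|)%N.
    apply: leq_trans cA; rewrite ltnS -[28%N]/(5 + 5 + 5 + 5 + 8)%N.
    do 4?[apply: leq_trans (leq_card_setU _ _) _; apply: leq_add => //].
    exact: leq_trans cPA _.
  have /subsetPn[a aA] : ~~ (A \subset D).
    by apply: contraL cD => /subset_leq_card; rewrite -leqNgt.
  rewrite /D !in_setU !in_setI !mem_nbr aA andbT !negb_or -!andbA => H.
  by exists a.
have: (#|P| + #|[set a]| <= 4)%N.
  apply: no_K5 => //; first by apply/cliqueP => i j /set1P-> /set1P->; rewrite eqxx.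
    by rewrite disjoint_sym disjoints1.
  by move=> p q pP /set1P->; move: pP => /setU1P[->|/setU1P[->|/set2P[]->]].
by rewrite cP cards1.
Qed.

(** An edge between two vertices outside and not touching the triangle would contradict [no_K5], so
    these are independent. Of the others, three form the triangle, at most ten are joined to each
    single corner only, and none is joined to two or three corners. *)
Lemma triangle_far x y z : e x y -> e x z -> e y z ->
  exists2 Y : {set T}, independent e Y & (#|~: Y| <= 33)%N.
Proof.
move=> xy xz yz.
have yx : e y x by rewrite e_sym.
have zx : e z x by rewrite e_sym.
have zy : e z y by rewrite e_sym.
pose P := x |: [set y; z].
have clP : clique e P by apply: (cliqueU1 e_sym); [exact: (clique2 e_sym)|move=> q /set2P[]->].
have cP : #|P| = 3%N.
  rewrite cardsU1 cards2 !inE !negb_or (adj_neq e_irr xy) (adj_neq e_irr xz).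
  by rewrite (adj_neq e_irr yz).
(* The independent set [A] contains at most one corner. *)
have cAP : (28 <= #|A :\: P|)%N.
  suff: (#|A :&: P| <= 1)%N.
    by have := cardsID P A; move: cA; set a := #|A|; set b := #|_ :&: _|; set c := #|_ :\: _|; lia.
  rewrite leqNgt; apply/negP => /card_gt1P[p [q [/setIP[pA pP] /setIP[qA qP] pq]]].
  have := (cliqueP _ _ clP) p q pP qP pq.
  by apply/negP; apply: (independentP _ _ indA).
have [B /subsetP BA cB] := exists_subset cAP.
have indB : independent e B.
  by apply: independentS indA; apply/subsetP => b /BA /setDP[].
have notP t : t \in P -> t \notin B by move=> tP; apply/negP => /BA /setDP[_]; rewrite tP.
have xB : x \notin B by apply: notP; rewrite !inE eqxx.
have yB : y \notin B by apply: notP; rewrite !inE eqxx orbT.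
have zB : z \notin B by apply: notP; rewrite !inE eqxx !orbT.
have nbrB t : (#|nbr e t B| <= 5)%N.
  apply: leq_trans (nbrA t); apply/subset_leq_card/nbrS.
  by apply/subsetP => b /BA /setDP[].
pose N := [set b in B | [|| e x b, e y b | e z b]].
(* The corners touch at most 15 vertices of [B], which excludes the alternative of 18 or more. *)
have cN : (#|N| <= 2)%N.
  have /orP[//|] := triangle_nbrs e_sym e_irr psd xy xz yz indB cB xB yB zB (erefl N).
  rewrite leqNgt ltnS; suff -> : (#|N| <= 17)%N by [].
  apply: (@leq_trans (5 + 5 + 5)%N) => //.
  apply: leq_trans (leq_add (leq_add (nbrB x) (nbrB y)) (nbrB z)).
  apply: leq_trans (leq_trans (leq_card_setU _ _) (leq_add (leq_card_setU _ _) (leqnn _))).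
  by apply/subset_leq_card/subsetP => b; rewrite !inE => /andP[-> /=]; rewrite orbA.
have cBN : (26 <= #|B :\: N|)%N.
  have := cardsID N B; have := subset_leq_card (subsetIr B N); rewrite cB.
  by move: cN; set a := #|N|; set b := #|_ :&: _|; set c := #|_ :\: _|; lia.
have [U /subsetP UB cU] := exists_subset cBN.
have indU : independent e U.
  by apply: independentS indB; apply/subsetP => b /UB /setDP[].
have nbrU t : (#|nbr e t U| <= 5)%N.
  apply: leq_trans (nbrB t); apply/subset_leq_card/nbrS.
  by apply/subsetP => b /UB /setDP[].
have farU t : t \in U -> [/\ [&& t != x, t != y & t != z], ~~ e x t, ~~ e y t & ~~ e z t].
  move=> /UB /setDP[tB]; rewrite inE tB !negb_or => /and3P[-> -> ->]; split=> //.
    apply/and3P; split.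
  - by apply: contraNneq xB => <-.
  - by apply: contraNneq yB => <-.
  - by apply: contraNneq zB => <-.
have far_xyz : far_from_triangle e x y z U.
  by move=> t /farU[/and3P[-> -> ->] -> -> ->].
have far_yxz : far_from_triangle e y x z U.
  by move=> t /farU[/and3P[-> -> ->] -> -> ->].
have far_zxy : far_from_triangle e z x y U.
  by move=> t /farU[/and3P[-> -> ->] -> -> ->].
have far_xzy : far_from_triangle e x z y U.
  by move=> t /farU[/and3P[-> -> ->] -> -> ->].
have far_yzx : far_from_triangle e y z x U.
  by move=> t /farU[/and3P[-> -> ->] -> -> ->].
have two p q r u : e p q -> e p r -> e q r -> far_from_triangle e p q r U ->
    e p u -> e q u -> ~~ e r u -> u != r -> False.
  move=> pq pr qr farp pu qu ru ur.
  have := two_nbrs_bound e_sym e_irr psd pq pr qr pu qu ru ur farp indU cU.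
  by rewrite ltnNge nbrU.
pose Wx := [set u | [&& e x u, ~~ e y u & ~~ e z u]].
pose Wy := [set u | [&& e y u, ~~ e x u & ~~ e z u]].
pose Wz := [set u | [&& e z u, ~~ e x u & ~~ e y u]].
have cWx : (#|Wx| <= 10)%N by exact: card_one_nbr xy xz yz far_xyz indU cU nbrU.
have cWy : (#|Wy| <= 10)%N by exact: card_one_nbr yx yz xz far_yxz indU cU nbrU.
have cWz : (#|Wz| <= 10)%N by exact: card_one_nbr zx zy xy far_zxy indU cU nbrU.
exists [set t in ~: P | [&& ~~ e x t, ~~ e y t & ~~ e z t]].
  apply/independentP => g h; rewrite !inE => /andP[gP /and3P[xg yg zg]].
  move=> /andP[hP /and3P[xh yh zh]]; apply/negP => gh.
  have: (#|P| + #|[set g; h]| <= 4)%N.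
    apply: no_K5 => //; first exact: (clique2 e_sym).
      by apply/pred0P => t /=; apply/negP => /andP[+ /set2P[]] => /[swap] ->;
        rewrite !inE ?(negbTE gP) ?(negbTE hP).
    by move=> p q pP /set2P[]->; move: pP => /setU1P[->|/set2P[]->].
  by rewrite cP cards2 (adj_neq e_irr gh).
apply: (@leq_trans (3 + 10 + 10 + 10)%N) => //.
apply: leq_trans (leq_add (leq_add (leq_add (leqnn _) cWx) cWy) cWz); rewrite -cP.
apply: (@leq_trans #|P :|: Wx :|: Wy :|: Wz|); last first.
  by do 3?[apply: leq_trans (leq_card_setU _ _) _; rewrite ?leq_add2r].
apply/subset_leq_card/subsetP => t.
rewrite in_setC in_setU in_setU in_setU inE in_setC negb_and negbK.
case: (boolP (t \in P)) => //= tP; rewrite !negb_and !negbK !inE.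
have [tx ty tz] : [/\ t != x, t != y & t != z].
  by move: tP; rewrite !inE !negb_or => /and3P[].
case: (boolP (e x t)) => xt; case: (boolP (e y t)) => yt; case: (boolP (e z t)) => zt //= _.
- by case: (no_K4 xy xz yz xt yt zt).
- by case: (two x y z t).
- by case: (two x z y t).
- by case: (two y z x t).
Qed.

End TriangleFar.

(** * Degrees at most 32 in a triangle-free graph *)

Section DegreeBound.
Variables (R : realFieldType) (T : finType) (e : rel T).
Hypotheses (e_sym : symmetric e) (e_irr : irreflexive e).
Hypothesis psd : forall f : T -> R, 0 <= qform e f f.

(** If there were exactly five, the test vector on [x], [y], these five and 24 other vertices of [O]
    would have value -64. *)
Lemma adjacent_nbrs x y (O : {set T}) :
  e x y -> independent e O -> (29 <= #|O|)%N -> y \notin O ->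
  x \notin O -> {in O, forall t, ~~ e x t} -> #|nbr e y O| != 5%N.
Proof.
move=> xy indO cO yO xO xO0; apply/negP => /eqP cN.
set N := nbr e y O in cN.
have NO : N \subset O := nbr_sub e y O.
have [M MO cM] : exists2 M : {set T}, M \subset O :\: N & #|M| = 24%N.
  apply: exists_subset; have := cardsID N O; rewrite (setIidPr NO) cN.
  by move: cO; set a := #|O|; set b := #|_ :\: _|; lia.
have MO' := subset_trans MO (subsetDl O N).
have dNM : [disjoint N & M] := disjointWr MO (disjointDr N O).
have := @class_test _ _ _ e_sym psd
  [:: (8, [set x]); (26, [set y]); (10, N); (-3, M)].
rewrite /= !disjoints1 in_set1 (adj_neq e_irr xy) dNM.
rewrite !(contra (subsetP NO _)) // !(contra (subsetP MO' _)) // => /(_ isT).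
have xN : edges e [set x] N = 0%N.
  by apply: edges0 => _ t /set1P-> /(subsetP NO); apply: xO0.
have xM : edges e [set x] M = 0%N.
  by apply: edges0 => _ t /set1P-> /(subsetP MO')/xO0.
have yN : edges e [set y] N = 5%N.
  by rewrite edges_full ?cards1 ?mul1n // => _ t /set1P->; rewrite inE => /andP[].
have yM : edges e [set y] M = 0%N.
  by apply: edges0 => _ t /set1P-> /(subsetP MO)/setDP[tO]; rewrite inE tO.
have NN : edges e N N = 0%N by apply: edges_independent indO _ _.
have NM : edges e N M = 0%N.
  by apply: edges_independent indO _ _.
have MM : edges e M M = 0%N.
  by apply: edges_independent indO _ _.
rewrite !big_cons !big_nil /= !edges11 !e_irr xy xN xM yN yM NN NM MM.
rewrite !cards1 cN cM /= => H; suff: 0 < 0 :> R by rewrite ltxx.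
by lra.
Qed.

Hypothesis triangle_free : forall x y z, e x y -> e x z -> ~~ e y z.

Lemma nbr_independent x (P : {set T}) : independent e (nbr e x P).
Proof.
apply/independentP => y z; rewrite !mem_nbr => /andP[_ xy] /andP[_ xz].
exact: triangle_free xy xz.
Qed.

Variable A : {set T}.
Hypotheses (indA : independent e A) (nbrA : forall u, (#|nbr e u A| <= 5)%N).

(* The threshold 34 comes from [maxA] in the proof of [no_small_posdef]: the
   neighbours of [v] together with the vector opposite to [v] are independent. *)
Lemma degree_in v : v \in A -> (34 <= #|A|)%N -> (#|nbr e v setT| <= 32)%N.
Proof.
move=> vA cA; rewrite leqNgt; apply/negP => /exists_subset[Y YN cY].
have [A0 /subsetP A0A cA0] : exists2 A0 : {set T}, A0 \subset A :\ v & #|A0| = 33%N.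
  by apply: exists_subset; move: cA; rewrite (cardsD1 v) vA.
have vY y : y \in Y -> e v y by move=> /(subsetP YN); rewrite mem_nbr => /andP[].
have vA0 : v \notin A0 by apply/negP => /A0A; rewrite !inE eqxx.
have YA y : y \in Y -> y \notin A.
  move=> /vY vy; apply/negP => yA.
  by move: vy; apply/negP; apply: (independentP _ _ indA).
have dis : [disjoint Y & A0].
  by apply/pred0P => t /=; apply/negP => /andP[/YA tA /A0A /setD1P[_]]; apply/negP.
(* One of the at most five neighbours of [y] in [A] is [v], which is not in [A0]. *)
have YA0 : (edges e Y A0 <= 33 * 4)%N.
  rewrite -{1}cY; apply: edges_le => y yY; rewrite -ltnS.
  apply: leq_trans (nbrA y); rewrite (cardsD1 v (nbr e y A)) mem_nbr vA.
  rewrite e_sym vY //= add1n ltnS; apply/subset_leq_card/subsetP => t.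
  by rewrite !inE => /andP[/A0A /setD1P[-> ->]].
have vv : edges e [set v] [set v] = 0%N by rewrite edges11 e_irr.
have EvY : edges e [set v] Y = 33%N.
  by rewrite edges_full ?cards1 ?mul1n // => _ t /set1P-> /vY.
have EvA : edges e [set v] A0 = 0%N.
  apply: edges0 => _ t /set1P-> /A0A /setD1P[_ tA].
  by apply: (independentP _ _ indA).
have EYY : edges e Y Y = 0%N by apply: edges_independent (nbr_independent v setT) _ _.
have EAA : edges e A0 A0 = 0%N.
  by apply: edges_independent indA _ _; apply/subsetP => t /A0A /setD1P[].
have := @class_test _ _ _ e_sym psd [:: (13, [set v]); (1, Y); (-1, A0)].
rewrite /= !disjoints1 dis vA0 (contraL (@YA v)) // => /(_ isT).
rewrite !big_cons !big_nil /= vv EvY EvA EYY EAA cY cA0 !cards1.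
have: (edges e Y A0)%:R <= 132 :> R by rewrite ler_nat.
move=> h /= H; suff: 0 < 0 :> R by rewrite ltxx.
by lra.
Qed.

(** At least 28 of 33 neighbours of [v] would lie outside [A]. Each of them has at most four
    neighbours among the vertices of [B] not joined to [v], so a vector weighting [v], these
    neighbours and the two parts of [B] has negative value. *)
Lemma degree_notin v : v \notin A -> (34 <= #|A|)%N -> (#|nbr e v setT| <= 32)%N.
Proof.
move=> vA /exists_subset[B BA cB]; rewrite leqNgt; apply/negP => dv.
have indB := independentS BA indA.
have nbrB t : (#|nbr e t B| <= 5)%N.
  by apply: leq_trans (nbrA t); apply/subset_leq_card/nbrS.
set N := nbr e v B; pose k := #|N|.
have NB : N \subset B := nbr_sub e v B.
have vB : v \notin B by apply: contra vA; apply: subsetP.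
have [Y /subsetP YN cY] : exists2 Y : {set T}, Y \subset nbr e v (~: A) & #|Y| = 28%N.
  apply: exists_subset; rewrite -(leq_add2r 5); apply: leq_trans dv _.
  apply: leq_trans (leq_add (leqnn _) (nbrA v)).
  apply: leq_trans (leq_card_setU _ _); apply/subset_leq_card/subsetP => t.
  by rewrite !inE /= => ->; rewrite !andbT orNb.
have vY y : y \in Y -> e v y by move=> /YN; rewrite mem_nbr => /andP[].
have YB y : y \in Y -> y \notin B.
  by move=> /YN; rewrite mem_nbr inE => /andP[yA _]; apply: contra yA; apply: subsetP.
have vO t : t \in B :\: N -> ~~ e v t.
  by rewrite in_setD mem_nbr => /andP[+ tB]; rewrite tB.
have cO : #|B :\: N|%:R = 34 - k%:R :> R.
  by rewrite -cB -(cardsID N B) (setIidPr NB) natrD addrC addKr.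
have k5 : (k <= 5)%N := nbrB v.
(* Five neighbours are excluded by [adjacent_nbrs], applicable since at least [34 - 5 = 29] vertices
   of [B] are not joined to [v]. *)
have EYO : (edges e Y (B :\: N) <= 28 * 4)%N.
  rewrite -{1}cY; apply: edges_le => y yY.
  have : (#|nbr e y (B :\: N)| <= 5)%N.
    by apply: leq_trans (nbrB y); apply/subset_leq_card/nbrS/subsetDl.
  rewrite leq_eqVlt ltnS => /orP[|//]; apply: contraLR => _.
  apply: (adjacent_nbrs (vY y yY)) => //.
  - exact: independentS (subsetDl B N) indB.
  - have := cardsID N B; rewrite (setIidPr NB) cB -/k.
    by move: k5; set a := #|_|; set c := k; lia.
  - by rewrite inE negb_and (YB y yY) orbT.
  - by rewrite inE negb_and vB orbT.
have vv : edges e [set v] [set v] = 0%N by rewrite edges11 e_irr.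
have EvY : edges e [set v] Y = 28%N.
  by rewrite edges_full ?cards1 ?mul1n // => _ t /set1P-> /vY.
have EvN : edges e [set v] N = k.
  by rewrite edges_full ?cards1 ?mul1n // => _ t /set1P->; rewrite mem_nbr => /andP[].
have EvO : edges e [set v] (B :\: N) = 0%N.
  by apply: edges0 => _ t /set1P-> /vO.
have EYY : edges e Y Y = 0%N.
  by apply: edges_independent (nbr_independent v (~: A)) _ _; apply/subsetP.
have EYN : edges e Y N = 0%N.
  by apply: edges0 => y t /vY vy; rewrite mem_nbr => /andP[_]; apply: triangle_free.
have ENN : edges e N N = 0%N by apply: edges_independent indB _ _.
have ENO : edges e N (B :\: N) = 0%N.
  by apply: edges_independent indB _ _; rewrite ?subsetDl.
have EOO : edges e (B :\: N) (B :\: N) = 0%N.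
  by apply: edges_independent indB _ _; rewrite ?subsetDl.
have dYB : [disjoint Y & B].
  by apply/pred0P => t /=; apply/negP => /andP[/YB /negP].
have dis : pairwise (fun p q : R * {set T} => [disjoint p.2 & q.2])
    [:: (60, [set v]); (5, Y); (16, N); (-5, B :\: N)].
  rewrite /= !disjoints1 disjointDr (disjointWr NB dYB).
  rewrite (disjointWr (subsetDl B N) dYB) (contra (@vY v)) ?e_irr //.
  by rewrite (contra (subsetP NB v)) // inE negb_and vB orbT.
(* This vector has negative value when [k <= 4], the next one when [k = 5]. *)
have := @class_test _ _ _ e_sym psd [:: (60, [set v]); (5, Y); (16, N); (-5, B :\: N)] dis.
have := @class_test _ _ _ e_sym psd [:: (30, [set v]); (2, Y); (8, N); (-3, B :\: N)] dis.
rewrite /= !big_cons !big_nil /= vv EvY EvN EvO EYY EYN ENN ENO EOO cY cO !cards1 -/k.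
have: (edges e Y (B :\: N))%:R <= 112 :> R by rewrite ler_nat.
move=> h /= H1 H2; suff: 0 < 0 :> R by rewrite ltxx.
by case: (k) k5 H1 H2 => [|[|[|[|[|[|//]]]]]] _ /= H1 H2; lra.
Qed.

End DegreeBound.

(** * Positive definiteness of [2I - E] on vertex sets *)

Section PositiveDefinite.
Variables (R : realFieldType) (T : finType) (e : rel T).
Hypotheses (e_sym : symmetric e) (e_irr : irreflexive e).
Implicit Types (f g v : T -> R) (B C P U Y Z : {set T}).

Definition posdef Z : Prop := forall f, (forall i, i \notin Z -> f i = 0) ->
  pform e f f <= 0 -> forall i, f i = 0.

(** The off-diagonal entries of [2I - E] are nonpositive. *)
Lemma pform_abs f : pform e (fun i => `|f i|) (fun i => `|f i|) <= pform e f f.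
Proof.
apply: lerB.
  by rewrite ler_pM2l //; apply: ler_sum => i _; rewrite -normrM ger0_norm // -expr2 sqr_ge0.
apply: ler_sum => i _; apply: ler_sum => j _.
by rewrite ler_wpM2l // -normrM ler_norm.
Qed.

Lemma pform_eq0 f g :
  (forall i, f i = 0 \/ g i = 0) ->
  (forall i j, e i j -> f i = 0 \/ g j = 0) -> pform e f g = 0.
Proof.
move=> fg efg; rewrite /pform big1 => [|i _]; last first.
  by case: (fg i) => ->; rewrite ?mul0r ?mulr0.
rewrite big1 => [|i _]; first by rewrite mulr0 subr0.
apply: big1 => j _; case: (boolP (e i j)) => [/efg[]->|_]; by rewrite ?(mul0r, mulr0).
Qed.

Lemma sum_gt0 f : (forall i, 0 <= f i) -> (exists i, f i != 0) -> 0 < \sum_i f i.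
Proof.
move=> f0 [i fi]; rewrite (bigD1 i) //= ltr_wpDr ?sumr_ge0 //.
by rewrite lt_def fi f0.
Qed.

(** The indicator of [Z] as test vector shows that the average degree inside [Z] is below 2. *)
Lemma posdef_ind Z : posdef Z -> Z != set0 -> (edges e Z Z < 2 * #|Z|)%N.
Proof.
move=> pdZ /set0Pn[i iZ]; rewrite ltnNge; apply/negP => le_ZZ.
have /(_ i)/eqP : forall i, ind R Z i = 0.
  apply: pdZ => [j jZ|]; first by rewrite /ind (negbTE jZ).
  by rewrite (pform_ind R e) setIid subr_le0 -natrM ler_nat.
by rewrite /ind iZ oner_eq0.
Qed.

Lemma posdefU Y Z : posdef Y -> posdef Z -> [disjoint Y & Z] ->
  {in Y & Z, forall y z, ~~ e y z} -> posdef (Y :|: Z).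
Proof.
move=> pdY pdZ dYZ eYZ f f0 pf.
pose g i := if i \in Y then f i else 0; pose h i := if i \in Z then f i else 0.
have fE : f =1 (fun i => 1 * g i + 1 * h i).
  move=> i; rewrite /g /h !mul1r; case: (boolP (i \in Y)) => iY.
    by rewrite (disjointFr dYZ iY) addr0.
  by case: (boolP (i \in Z)) => iZ; rewrite ?add0r // f0 ?inE ?negb_or ?iY.
have gh0 : pform e g h = 0.
  apply: pform_eq0 => [i|i j eij]; rewrite /g /h.
    case: (boolP (i \in Y)) => iY; last by left.
    by right; rewrite (disjointFr dYZ iY).
  case: (boolP (i \in Y)) => iY; last by left.
  right; case: ifP => // jZ; by move: (eYZ i j iY jZ); rewrite eij.
have pdP Z' f' : posdef Z' -> (forall i, i \notin Z' -> f' i = 0) -> 0 <= pform e f' f'.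
  move=> pd f'0; rewrite leNgt; apply/negP => neg.
  have f'E := pd f' f'0 (ltW neg); move: neg.
  by rewrite pform_eq0 ?ltxx // => *; left.
have gY i : i \notin Y -> g i = 0 by rewrite /g => /negbTE->.
have hZ i : i \notin Z -> h i = 0 by rewrite /h => /negbTE->.
have pg := pdP _ _ pdY gY; have ph := pdP _ _ pdZ hZ.
move: pf; rewrite (eq_pform e fE fE) pform_comb // gh0 => pf.
have g0 := pdY g gY; have h0 := pdZ h hZ.
by move=> i; rewrite fE g0 ?h0; lra.
Qed.

(** Since the average degree is below 2, some vertex has at most one neighbour in [Z]. Choose it,
    delete it with its neighbour, and repeat. *)
Lemma forest_independent Z : posdef Z ->
  exists I : {set T}, [/\ I \subset Z, independent e I & (#|Z| <= 2 * #|I|)%N].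
Proof.
have [n] := ubnP #|Z|; elim: n => // n IH in Z *; rewrite ltnS => Zn pdZ.
have [->|Z0] := eqVneq Z set0.
  by exists set0; split; rewrite ?sub0set ?cards0 //; apply/independentP => x y; rewrite inE.
have := posdef_ind pdZ Z0; rewrite /edges => lt_Z.
have [i iZ di] : exists2 i, i \in Z & (#|nbr e i Z| <= 1)%N.
  apply/exists_inP; apply: contraLR lt_Z; rewrite negb_exists_in -leqNgt mulnC.
  by rewrite -sum_nat_const => /forall_inP H; apply: leq_sum => i /H; rewrite -ltnNge.
pose Z' := Z :\: (i |: nbr e i Z).
have Z'Z : Z' \subset Z := subsetDl _ _.
have iN : i \notin nbr e i Z by rewrite mem_nbr e_irr andbF.
have cZ : (#|Z| <= #|Z'| + 2)%N.
  rewrite -(cardsID (i |: nbr e i Z) Z) addnC leq_add2l.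
  by apply: leq_trans (subset_leq_card (subsetIr _ _)) _; rewrite cardsU1 iN.
have ltZ' : (#|Z'| < #|Z|)%N.
  by apply: proper_card; rewrite properE Z'Z; apply/subsetPn; exists i; rewrite // !inE eqxx.
have pdZ' : posdef Z'.
  by move=> f f0; apply: pdZ => j jZ; apply: f0; apply: contra jZ; apply: subsetP.
have [I [IZ' indI cI]] := IH Z' (leq_trans ltZ' Zn) pdZ'.
have iI : i \notin I by apply/negP => /(subsetP IZ'); rewrite !inE eqxx.
exists (i |: I); split.
- by rewrite subUset sub1set iZ (subset_trans IZ').
- have iIe j : j \in I -> ~~ e i j.
    by move=> /(subsetP IZ'); rewrite !inE => /andP[+ jZ]; rewrite jZ negb_or => /andP[].
  apply/independentP => x y /setU1P[->|xI] /setU1P[->|yI].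
  + by rewrite e_irr.
  + exact: iIe.
  + by rewrite e_sym iIe.
  + exact: (independentP _ _ indI).
- by rewrite cardsU1 iI mulnDr muln1 addnC (leq_trans cZ) // leq_add2r.
Qed.

Section FarSets.
Hypothesis psd : forall f, 0 <= qform e f f.

(** Suppose [f] on [Z] is nonzero with nonpositive value; so is [|f|]. Scale [|f|] and [v] to equal
    coordinate sums and subtract: the [J] term and the mixed term vanish, and the negative value of
    [v] contradicts semidefiniteness. *)
Lemma far_posdef v Z : (forall i, 0 <= v i) -> pform e v v < 0 ->
  {in Z, forall i, v i = 0} -> {in Z, forall i j, e i j -> v j = 0} -> posdef Z.
Proof.
move=> v0 pv vZ evZ f f0 pf i; apply/eqP; apply: contraTT isT => fi.
pose g j := `|f j|; pose a := \sum_j v j; pose b := \sum_j g j.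
have a_gt0 : 0 < a.
  apply: sum_gt0 => //; apply/existsP; apply: contraLR pv => /existsPn v00.
  by rewrite -leNgt pform_eq0 // => *; left; apply/eqP; rewrite -[_ == _]negbK v00.
have b_gt0 : 0 < b by apply: sum_gt0 => [j|]; rewrite /g ?normr_ge0 //; exists i; rewrite normr_eq0.
have gv : pform e g v = 0.
  apply: pform_eq0 => [j|j k ejk]; have [jZ|jZ] := boolP (j \in Z).
  - by right; apply: vZ.
  - by left; rewrite /g f0 ?normr0.
  - by right; apply: evZ ejk.
  - by left; rewrite /g f0 ?normr0.
have pg : pform e g g <= 0 := le_trans (pform_abs f) pf.
have := psd (fun j => a * g j + - b * v j).
rewrite /qform pform_comb // gv big_split /= -!mulr_sumr -/a -/b.
have -> : a * b + - b * a = 0 by ring.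
have h1 : a ^+ 2 * pform e g g <= 0 by rewrite mulr_ge0_le0 ?sqr_ge0.
have h2 : b ^+ 2 * pform e v v < 0 by rewrite pmulr_rlt0 ?exprn_gt0.
by rewrite leNgt => /negP[]; lra.
Qed.

Definition closed_nbr P : {set T} := P :|: \bigcup_(i in P) nbr e i setT.

Lemma card_bigcup_nbr P c : (forall i, (#|nbr e i setT| <= c)%N) ->
  (#|\bigcup_(i in P) nbr e i setT| <= #|P| * c)%N.
Proof.
move=> dc; rewrite -sum_nat_const; elim/big_rec2: _ => [|i n U _ Un].
  by rewrite cards0.
exact: leq_trans (leq_card_setU _ _) (leq_add (dc i) Un).
Qed.

Lemma far_closed_nbr v P : (forall i, 0 <= v i) -> pform e v v < 0 ->
  (forall i, i \notin P -> v i = 0) -> posdef (~: closed_nbr P).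
Proof.
move=> v0 pv vP; apply: far_posdef pv _ _ => // i;
  rewrite inE /closed_nbr inE negb_or => /andP[iP iN].
  exact: vP.
move=> j eij; apply: vP; apply: contra iN => jP.
by apply/bigcupP; exists j => //; rewrite mem_nbr inE e_sym.
Qed.

End FarSets.
End PositiveDefinite.

(** * Connected sets, and a positive definite set of density 10/14 *)

Section Chunks.
Variables (R : realFieldType) (T : finType) (e : rel T).
Hypotheses (e_sym : symmetric e) (e_irr : irreflexive e).
Implicit Types (f g : T -> R) (B C P S U Y Z : {set T}).
Hypothesis triangle_free : forall x y z, e x y -> e x z -> ~~ e y z.

Lemma comb_ge0 (s : seq (R * {set T})) : all (fun p => 0 <= p.1) s ->
  forall i, 0 <= comb s i.
Proof.
move=> /allP s0 i; rewrite /comb big_seq; apply: sumr_ge0 => p ps.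
by rewrite mulr_ge0 ?s0 // /ind; case: (_ \in _).
Qed.

(** A star with five leaves has value -2 for the weights 2 at the centre and 1 on the leaves, so the
    vertices far from it induce a positive definite form and contain many independent ones; together
    with the leaves these violate [star_bound]. *)
Lemma degree_le4 v : (forall f, 0 <= qform e f f) ->
  (forall u, (#|nbr e u setT| <= 32)%N) -> (277 <= #|T|)%N ->
  (#|nbr e v setT| <= 4)%N.
Proof.
move=> psd deg32 cT; rewrite leqNgt; apply/negP => /exists_subset[L LN cL].
have vL l : l \in L -> e v l by move=> /(subsetP LN); rewrite mem_nbr => /andP[].
have indL : independent e L by apply: independentS LN (nbr_independent triangle_free v _).
have v_notL : v \notin L by apply/negP => /vL; rewrite e_irr.
pose s : seq (R * {set T}) := [:: (2, [set v]); (1, L)].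
pose P := v |: L.
have ps : pform e (comb s) (comb s) < 0.
  rewrite pform_comb_disjoint //= ?disjoints1 ?v_notL // !big_cons !big_nil /=.
  have -> : edges e L L = 0%N by apply: edges_independent indL _ _.
  have -> : edges e [set v] L = 5%N.
    by rewrite edges_full ?cards1 ?cL // => _ t /set1P-> /vL.
  by rewrite edges11 // e_irr cards1 cL /=; lra.
pose Z := ~: closed_nbr e P.
have pdZ : posdef R e Z.
  apply: (far_closed_nbr e_sym psd _ ps) => [|i]; first by apply: comb_ge0; rewrite /= ler0n ler01.
  rewrite !inE negb_or => /andP[iv iL].
  by rewrite /comb !big_cons big_nil /ind /= inE (negbTE iv) (negbTE iL) !mulr0 !addr0.
have cZ : (85 <= #|Z|)%N.
  (* Every vertex of the star has a neighbour in it, so the closed neighbourhood has at most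
     [6 * 32 = 192] vertices, and [277 - 192 = 85]. *)
  have Nsub : closed_nbr e P = \bigcup_(i in P) nbr e i setT.
    apply/setUidPr/subsetP => t /setU1P[->|tL]; apply/bigcupP.
      have /card_gt0P[l lL] : (0 < #|L|)%N by rewrite cL.
      by exists l; rewrite ?inE ?lL ?orbT //= e_sym vL.
    by exists v; rewrite ?inE ?eqxx //= vL.
  have := card_bigcup_nbr P deg32; rewrite -Nsub cardsU1 v_notL cL.
  have := cardsC (closed_nbr e P); rewrite -/Z.
  by move: cT; set a := #|T|; set b := #|Z|; set c := #|closed_nbr e P|; lia.
have [I0 [I0Z indI0 cI0]] := forest_independent e_sym e_irr pdZ.
(* With five leaves, 41 is the least size for which [(5 - 4) (41 - 4)] exceeds 36. *)
have [I /subsetP II0 cI] : exists2 I : {set T}, I \subset I0 & #|I| = 41%N.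
  by apply: exists_subset; move: cZ cI0; set a := #|Z|; set b := #|I0|; lia.
have farI i : i \in I -> i \notin P /\ forall j, j \in P -> ~~ e j i.
  move=> /II0 /(subsetP I0Z); rewrite in_setC in_setU negb_or => /andP[iP iN].
  split=> // j jP.
  by apply: contra iN => ji; apply/bigcupP; exists j => //; rewrite mem_nbr inE.
have vP : v \in P by rewrite !inE eqxx.
have LP l : l \in L -> l \in P by move=> lL; rewrite !inE lL orbT.
have indLI : independent e (L :|: I).
  apply/independentP => a b /setUP[aL|aI] /setUP[bL|bI].
  - exact: (independentP _ _ indL).
  - by have [_ ->] := farI b bI; rewrite ?LP.
  - by rewrite e_sym; have [_ ->] := farI a aI; rewrite ?LP.
  - by apply: (independentP _ _ indI0); apply: II0.
suff H : (#|L|%:R - 4) * (#|I|%:R - 4) <= 36 :> R.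
  by suff: 0 < 0 :> R by [rewrite ltxx]; move: H; rewrite cL cI; lra.
apply: (star_bound e_sym e_irr psd _ indLI _ vL).
- by apply/negP => /farI[]; rewrite vP.
- by apply/pred0P => t /=; apply/negP => /andP[/LP tP /farI[]]; rewrite tP.
- by move=> t /farI[_]; apply.
Qed.

Hypothesis local_psd : forall f, (forall i, 0 <= f i) ->
  (#|[set i | f i != 0%R]| <= 15)%N -> 0 <= pform e f f.

(** Connectedness is stated through cuts, because the proofs need an edge leaving the support of a
    vector. *)
Definition connected_set C : Prop := forall B, B \subset C -> B != set0 -> B != C ->
  exists i j, [/\ i \in B, j \in C :\: B & e i j].

Lemma pform_indr f j : pform e f (ind R [set j]) = 2 * f j - \sum_i (e i j)%:R * f i.
Proof.
rewrite /pform; congr (_ * _ - _).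
  rewrite (bigD1 j) //= /ind inE eqxx mulr1 big1 ?addr0 // => i ij.
  by rewrite inE (negbTE ij) mulr0.
apply: eq_bigr => i _; rewrite (bigD1 j) //= /ind inE eqxx mulr1 big1 ?addr0 // => k kj.
by rewrite inE (negbTE kj) !mulr0.
Qed.

(* If the form were nonpositive at a nonzero [f] supported in [B], putting a small
   value at a vertex of [C] outside the support and adjacent to it would make
   it negative. *)
Lemma proper_posdef B C : connected_set C -> (#|C| <= 15)%N -> B \subset C -> B != C ->
  posdef R e B.
Proof.
move=> conC cC BC neBC f f0 pf i0; apply/eqP; apply: contraTT isT => fi0.
pose g i := `|f i|; pose D := [set i | g i != 0].
have g0 i : 0 <= g i by apply: normr_ge0.
have DB : D \subset B.
  by apply/subsetP => i; rewrite inE; apply: contraR => /f0 fi; rewrite /g fi normr0.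
have D0 : D != set0 by apply/set0Pn; exists i0; rewrite inE normr_eq0.
have DC : D != C.
  by apply: contraNneq neBC => DC; rewrite eqEsubset BC -DC.
have [i [j [iD /setDP[jC jD] eij]]] := conC D (subset_trans DB BC) D0 DC.
have gj : g j = 0 by apply/eqP; move: jD; rewrite inE negbK.
have gi : 0 < g i by rewrite lt_def g0 andbT; move: iD; rewrite inE.
(* A value [t] at [j] changes the form by at most [2 t^2 - 2 t (g i)], which is least at
   [t = g i / 2]. *)
pose h k := 1 * g k + (g i / 2) * ind R [set j] k.
have h0 k : 0 <= h k.
  by rewrite addr_ge0 ?mulr_ge0 ?invr_ge0 ?ler0n //; apply: (ltW gi).
have supp_h : (#|[set k | h k != 0%R]| <= 15)%N.
  apply: leq_trans cC; apply/subset_leq_card/subsetP => k; rewrite inE.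
  apply: contraR => kC; rewrite /h /g f0 ?normr0; last by apply: contra kC; apply: subsetP.
  rewrite /ind inE; have [kj|_] := eqVneq k j; first by rewrite kj jC in kC.
  by rewrite !mulr0 addr0.
have := local_psd h0 supp_h.
rewrite pform_comb // pform_indr gj (pform_ind R e) setIid cards1 edges11 // e_irr.
have le_sum : g i <= \sum_k (e k j)%:R * g k.
  rewrite (bigD1 i) //= eij mul1r lerDl sumr_ge0 // => k _.
  by rewrite mulr_ge0 ?ler0n.
have pg : pform e g g <= 0 := le_trans (pform_abs e f) pf.
have h1 : 0 <= g i * (\sum_k (e k j)%:R * g k - g i) by rewrite mulr_ge0 ?subr_ge0 // ltW.
have h2 : 0 < g i * g i by rewrite mulr_gt0.
move: h1 h2 pg; set q := \sum_k _ => /= h1 h2 pg H.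
suff: 0 < 0 :> R by rewrite ltxx.
by lra.
Qed.

Lemma pform_ind_nbr f C :
  pform e f (ind R C) = \sum_i f i * (2 * (i \in C)%:R - #|nbr e i C|%:R).
Proof.
rewrite /pform mulr_sumr -sumrB; apply: eq_bigr => i _.
rewrite mulrBr [in RHS]mulrCA /ind; congr (_ - _).
rewrite -sum_ind1 mulr_sumr; apply: eq_bigr => j _; rewrite /ind inE mulrCA -natrM.
by case: (e i j); case: (j \in C).
Qed.

(* Subtracting the least value of a positive null vector gives a vector of
   smaller support on which the form would be negative. *)
Lemma path_posdef C : connected_set C -> (#|C| <= 15)%N ->
  {in C, forall i, (#|nbr e i C| <= 2)%N} -> (edges e C C < 2 * #|C|)%N ->
  posdef R e C.
Proof.
move=> conC cC deg2 ltC f f0 pf i0; apply/eqP; apply: contraTT isT => fi0.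
pose g i := `|f i|; pose D := [set i | g i != 0].
have g0 i : 0 <= g i by apply: normr_ge0.
have DC : D \subset C.
  by apply/subsetP => i; rewrite inE; apply: contraR => /f0 fi; rewrite /g fi normr0.
have [DE|neDC] := eqVneq D C; last first.
  have fD i : i \notin D -> f i = 0.
    by rewrite inE negbK normr_eq0 => /eqP.
  by have := proper_posdef conC cC DC neDC fD pf i0; move/eqP; rewrite (negbTE fi0).
have i0C : i0 \in C by rewrite -DE inE normr_eq0.
have [m mC m_min] : exists2 m, m \in C & {in C, forall i, g m <= g i}.
  by case: (arg_minP g i0C) => m mC m_min; exists m.
have gm : 0 < g m by rewrite lt_def g0 andbT; move: mC; rewrite -DE inE.
pose h i := 1 * g i + (- g m) * ind R C i.
have gC i : i \notin C -> g i = 0 by move=> iC; rewrite /g f0 ?normr0.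
have h0 i : 0 <= h i.
  rewrite /h /ind; case: (boolP (i \in C)) => [/m_min|/gC->]; last by rewrite !mulr0 addr0.
  by move=> gmi /=; lra.
have supp_h : (#|[set k | h k != 0%R]| <= 15)%N.
  apply: leq_trans cC; apply/subset_leq_card/subsetP => k; rewrite inE.
  by apply: contraR => kC; rewrite /h /ind (negbTE kC) gC // !mulr0 addr0.
have := local_psd h0 supp_h; rewrite pform_comb // pform_ind_nbr (pform_ind R e) setIid.
have pg : pform e g g <= 0 := le_trans (pform_abs e f) pf.
have lt1 : (edges e C C)%:R < 2 * #|C|%:R :> R by rewrite -natrM ltr_nat.
(* Degrees at most 2 make the coefficients nonnegative on [C], so [g] may be replaced there by its
   minimum. *)
have le_sum : g m * (2 * #|C|%:R - (edges e C C)%:R)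
    <= \sum_i g i * (2 * (i \in C)%:R - #|nbr e i C|%:R).
  rewrite (bigID (mem C)) /= [X in _ <= _ + X]big1 => [|i /gC->]; last by rewrite mul0r.
  rewrite addr0 -sum1_card /edges !natr_sum mulr_sumr -sumrB mulr_sumr.
  apply: ler_sum => i iC; rewrite iC; apply: ler_pM => //; rewrite ?m_min //.
    by rewrite mulr1 subr_ge0 ler_nat deg2.
have h1 : 0 < g m * (g m * (2 * #|C|%:R - (edges e C C)%:R)).
  by rewrite !mulr_gt0 ?subr_gt0.
have h2 : 0 <= g m * (\sum_i g i * (2 * (i \in C)%:R - #|nbr e i C|%:R)
    - g m * (2 * #|C|%:R - (edges e C C)%:R)).
  by rewrite mulr_ge0 ?subr_ge0.
move: h1 h2 pg; set q := \sum_i _; set c := #|C|%:R; set d := (edges e C C)%:R => h1 h2 pg H.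
suff: 0 < 0 :> R by rewrite ltxx.
by lra.
Qed.

(** Without triangles, a connected set of at most three vertices is a path: some vertex has degree
    at most 1 and the others at most 2. *)
Lemma small_posdef C : connected_set C -> C != set0 -> (#|C| <= 3)%N -> posdef R e C.
Proof.
move=> conC C0 cC.
have deg2 i : i \in C -> (#|nbr e i C| <= 2)%N.
  move=> iC; rewrite -ltnS; apply: leq_trans cC; apply: proper_card.
  by rewrite properE nbr_sub; apply/subsetPn; exists i; rewrite // mem_nbr e_irr andbF.
apply: path_posdef => //; first by apply: leq_trans cC _.
have [i iC di] : exists2 i, i \in C & (#|nbr e i C| <= 1)%N.
  apply/exists_inP; apply: contraT; rewrite negb_exists_in => /forall_inP all2.
  have /set0Pn[i iC] := C0.
  have := all2 i iC; rewrite -ltnNge => /card_gt1P[j [k [jN kN jk]]].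
  move: jN kN; rewrite !mem_nbr => /andP[jC ij] /andP[kC ik].
  have := all2 j jC; rewrite -ltnNge ltnNge => /negP[].
  have: nbr e j C \subset C :\ j :\ k.
    apply/subsetP => t; rewrite mem_nbr => /andP[tC jt]; rewrite !inE tC andbT.
    rewrite [t == j]eq_sym (adj_neq e_irr jt) andbT.
    by apply: contraTneq jt => ->; apply: triangle_free ij ik.
  move=> /subset_leq_card/leq_trans; apply.
  have := cardsD1 j C; have := cardsD1 k (C :\ j); rewrite jC !inE kC eq_sym jk /=.
  by move: cC; set a := #|C|; set b := #|C :\ j|; set c := #|_ :\ k|; lia.
rewrite /edges (bigD1 i) //= (cardsD1 i C) iC.
apply: (@leq_trans (2 + \sum_(j in C :\ i) 2)); last by rewrite sum_nat_const; lia.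
rewrite -addSn; apply: leq_add; first exact: di.
rewrite [X in (X <= _)%N](eq_bigl (mem (C :\ i))) => [|j]; last by rewrite !inE andbC.
by apply: leq_sum => j /setD1P[_ /deg2].
Qed.

Lemma connected_set1 u : connected_set [set u].
Proof.
by move=> B; rewrite subset1 => /orP[]/eqP->; rewrite eqxx.
Qed.

Lemma connected_setU1 C i j : connected_set C -> i \in C -> j \notin C -> e i j ->
  connected_set (j |: C).
Proof.
move=> conC iC jC ij B BjC B0 neB.
have [jB|jB] := boolP (j \in B).
  have B'C : B :\ j \subset C by rewrite subDset.
  have [B'0|B'0] := eqVneq (B :\ j) set0.
    exists j, i; rewrite jB e_sym ij !inE iC orbT andbT; split=> //.
    apply/negP => iB; have : i \in B :\ j by rewrite !inE iB (adj_neq e_irr ij).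
    by rewrite B'0 inE.
  have neB' : B :\ j != C by apply: contraNneq neB => <-; rewrite setD1K.
  have [a [b [/setD1P[_ aB] /setDP[bC bB'] ab]]] := conC _ B'C B'0 neB'.
  exists a, b; split=> //; rewrite !inE bC orbT andbT.
  by apply: contra bB' => bB; rewrite !inE bB andbT; apply: contraNneq jC => <-.
have BC : B \subset C.
  apply/subsetP => t tB; have /setU1P[tj|//] := subsetP BjC t tB.
  by rewrite -tj tB in jB.
have [BE|neBC] := eqVneq B C.
  by exists i, j; rewrite BE !inE eqxx iC jC.
have [a [b [aB /setDP[bC bB] ab]]] := conC _ BC B0 neBC.
by exists a, b; split=> //; rewrite !inE bB bC orbT.
Qed.

Lemma edges_setU1 C i j : i \in C -> j \notin C -> e i j ->
  (edges e C C + 2 <= edges e (j |: C) (j |: C))%N.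
Proof.
move=> iC jC ij.
have nbrU k : (#|nbr e k C| + e k j <= #|nbr e k (j |: C)|)%N.
  case: (boolP (e k j)) => kj /=; last by rewrite addn0 subset_leq_card // nbrS ?subsetUr.
  rewrite (cardsD1 j (nbr e k (j |: C))) mem_nbr kj !inE eqxx addnC leq_add2l.
  apply/subset_leq_card/subsetP => t; rewrite !inE => /andP[tC ->]; rewrite tC orbT !andbT.
  by apply: contraNneq jC => <-.
rewrite [X in (_ <= X)%N]/edges big_setU1 //=.
apply: (@leq_trans (1 + (1 + edges e C C))%N); first by rewrite addnC addnA.
apply: leq_add.
  by apply/card_gt0P; exists i; rewrite mem_nbr e_sym ij !inE iC orbT.
apply: (@leq_trans (\sum_(k in C) (#|nbr e k C| + e k j))); last exact: leq_sum.
by rewrite big_split /= addnC leq_add2l (bigD1 i) //= ij.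
Qed.

(** Vertices are added one at a time until the size is [k] or no neighbour in [U] is left outside.
    The edge inequality records the at least [#|C| - 1] edges of a spanning tree. *)
Lemma connected_grow U u k : u \in U -> (0 < k)%N -> exists C,
  [/\ C \subset U, u \in C, connected_set C, (2 * #|C| <= edges e C C + 2)%N
    & (#|C| = k) \/ ((#|C| < k)%N /\ {in C, forall i, nbr e i U \subset C})].
Proof.
move=> uU; elim: k => // [[_ _|k IH _]].
  exists [set u]; rewrite sub1set uU inE eqxx cards1; split=> //.
  - exact: connected_set1.
  - by rewrite leq_addl.
  - by left.
have [//|C [CU uC conC eC [cC|[cC clC]]]] := IH; last first.
  by exists C; split=> //; right; rewrite ltnW.
have [clC|] := boolP [forall i in C, nbr e i U \subset C].
  by exists C; split=> //; right; rewrite cC; split=> // i iC; apply: (forall_inP clC).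
rewrite negb_forall_in => /exists_inP[i iC /subsetPn[j]]; rewrite mem_nbr => /andP[jU ij] jC.
exists (j |: C); split.
- by rewrite subUset sub1set jU.
- by rewrite inE uC orbT.
- exact: connected_setU1 ij.
- have := edges_setU1 iC jC ij; rewrite cardsU1 jC.
  by move: eC; set a := edges _ _ _; set b := edges _ _ _; set c := #|C|; lia.
- by left; rewrite cardsU1 jC cC.
Qed.

(** With at least nine edges inside [C], weight 2 on [C] and 1 on five outside neighbours give at
    most [4 (20 - 18) + 10 - 20 = -2] on a support of 15 vertices. *)
Lemma boundary_le4 C S : #|C| = 10%N ->
  (2 * #|C| <= edges e C C + 2)%N -> [disjoint C & S] ->
  {in S, forall j, exists2 i, i \in C & e i j} -> (#|S| <= 4)%N.
Proof.
move=> cC eC dCS nbrS; rewrite leqNgt; apply/negP => /exists_subset[S5 S5S cS5].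
have dis := disjointWr S5S dCS.
pose s : seq (R * {set T}) := [:: (2, C); (1, S5)].
have s0 : forall i, 0 <= comb s i by apply: comb_ge0; rewrite /= ler0n ler01.
have supp : (#|[set i | comb s i != 0%R]| <= 15)%N.
  apply: (@leq_trans #|C :|: S5|).
    apply/subset_leq_card/subsetP => i; rewrite inE; apply: contraR.
    rewrite inE negb_or => /andP[iC iS].
    by rewrite /comb !big_cons big_nil /ind /= (negbTE iC) (negbTE iS) !mulr0 !addr0.
  by apply: leq_trans (leq_card_setU _ _) _; rewrite cC cS5.
have := local_psd s0 supp; rewrite pform_comb_disjoint //= ?dis //.
rewrite !big_cons !big_nil /= cC cS5.
have h1 : 18 <= (edges e C C)%:R :> R.
  by rewrite ler_nat -(leq_add2r 2) (leq_trans _ eC) // cC.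
have h2 : 5 <= (edges e C S5)%:R :> R.
  rewrite ler_nat edgesC // -cS5 -sum1_card; apply: leq_sum => j jS.
  have [i iC eij] := nbrS j (subsetP S5S _ jS).
  by apply/card_gt0P; exists i; rewrite mem_nbr iC e_sym.
have h3 : 0 <= (edges e S5 S5)%:R :> R by apply: ler0n.
move=> H; suff: 0 < 0 :> R by rewrite ltxx.
by lra.
Qed.

(** Grow [C] up to ten vertices, discard its outside neighbours [S] in [U], and recurse on the rest,
    which has no edge to [C]. It remains to keep enough of [C]. *)
Lemma large_posdef U :
  exists Y, [/\ Y \subset U, (10 * #|U| <= 14 * #|Y|)%N & posdef R e Y].
Proof.
have [n] := ubnP #|U|; elim: n => // n IH in U *; rewrite ltnS => Un.
have [->|/set0Pn[u uU]] := eqVneq U set0.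
  exists set0; split; rewrite ?sub0set ?cards0 // => f f0 _ i.
  by apply: f0; rewrite inE.
have [//|C [CU uC conC eC cC]] := @connected_grow U u 10 uU _.
have C0 : C != set0 by apply/set0Pn; exists u.
have leC : (#|C| <= 10)%N by case: cC => [->|[/ltnW]].
pose S := [set j in U :\: C | [exists i in C, e i j]].
have SU : S \subset U.
  by apply/subsetP => j; rewrite inE => /andP[/setDP[]].
have dCS : [disjoint C & S].
  by apply/pred0P => j /=; rewrite !inE; case: (j \in C).
pose U' := U :\: (C :|: S).
have U'U : U' \subset U := subsetDl _ _.
have uU' : u \notin U' by rewrite !inE uC.
have ltU' : (#|U'| < n)%N.
  by apply: leq_trans Un; apply: proper_card; rewrite properE U'U; apply/subsetPn; exists u.
have [Y' [Y'U' cY' pdY']] := IH _ ltU'.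
have cU : #|U| = (#|U'| + #|C| + #|S|)%N.
  have CSU : C :|: S \subset U by rewrite subUset CU.
  rewrite -(cardsID (C :|: S) U) (setIidPr CSU) addnC -addnA; congr addn.
  by rewrite cardsU disjoint_setI0 // cards0 subn0.
have farY' i j : i \in C -> j \in Y' -> ~~ e i j.
  move=> iC /(subsetP Y'U'); rewrite !inE negb_or => /andP[/andP[jC jS] jU].
  by apply: contra jS => eij; rewrite jC jU; apply/existsP; exists i; rewrite iC.
have dCY' : [disjoint C & Y'].
  apply/pred0P => j /=; apply/negP => /andP[jC /(subsetP Y'U')].
  by rewrite !inE jC.
suff [D [DC cD pdD]] : exists D : {set T}, [/\ D \subset C,
    (10 * (#|C| + #|S|) <= 14 * #|D|)%N & posdef R e D].
  have dDY' := disjointWl DC dCY'.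
  exists (D :|: Y'); split.
  - by rewrite subUset (subset_trans DC) // (subset_trans Y'U').
  - rewrite cU cardsU disjoint_setI0 // cards0 subn0.
    by rewrite -addnA mulnDr [X in (_ <= X)%N]mulnDr addnC leq_add.
  - by apply: (posdefU e_sym) => // i j /(subsetP DC); apply: farY'.
have [S0|/set0Pn[j jS]] := eqVneq S set0.
  have [cC3|cC3] := leqP #|C| 3.
    exists C; split=> //; last exact: small_posdef.
    by rewrite S0 cards0 addn0 leq_mul2r orbT.
  exists (C :\ u); split; first exact: subsetDl.
    move: cC3; rewrite S0 cards0 addn0 (cardsD1 u C) uC ltnS => cC3.
    (* With [c >= 3] kept vertices, [10 (c + 1) <= 14 c] amounts to [10 <= 4 c]. *)
    rewrite mulnDr muln1 -[14%N]/(4 + 10)%N mulnDl leq_add2r.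
    by apply: leq_trans (leq_mul (leqnn 4) cC3).
  apply: (proper_posdef conC); rewrite ?subsetDl ?(leq_trans leC) //.
  by apply: contraTneq uC => <-; rewrite !inE eqxx.
have [i iC eij] : exists2 i, i \in C & e i j.
  by move: jS; rewrite inE => /andP[_ /existsP[i /andP[iC eij]]]; exists i.
have jC : j \notin C by move: jS; rewrite !inE => /andP[/andP[]].
have cC10 : #|C| = 10%N.
  case: cC => // -[_ clC]; have := subsetP (clC i iC) j.
  by rewrite mem_nbr eij (subsetP SU) // (negbTE jC) => /(_ isT).
exists C; split=> //.
  have : (#|S| <= 4)%N.
    apply: (boundary_le4 cC10) => // k.
    by rewrite inE => /andP[_ /existsP[l /andP[lC elk]]]; exists l.
  by rewrite cC10 -[(14 * 10)%N]/(10 * (10 + 4))%N leq_mul2l leq_add2l.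
(* All of [C] is kept, being a proper subset of a connected set of 11 vertices. *)
apply: (proper_posdef (connected_setU1 conC iC jC eij)).
- by rewrite cardsU1 jC cC10.
- exact: subsetUr.
- by apply: contraNneq jC => ->; rewrite !inE eqxx.
Qed.

End Chunks.

(** * Contradiction if all positive definite sets of the switched graph are small *)

Section Core.
Variables (R : realFieldType) (T : finType) (e : rel T).
Hypotheses (e_sym : symmetric e) (e_irr : irreflexive e).
Hypothesis psd : forall f : T -> R, 0 <= qform e f f.

Lemma independent_posdef (Y : {set T}) : independent e Y -> posdef R e Y.
Proof.
move=> indY f f0 pf i.
have e0 : \sum_i \sum_j (e i j)%:R * (f i * f j) = 0.
  apply: big1 => a _; apply: big1 => b _.
  have [aY|/f0->] := boolP (a \in Y); last by rewrite mul0r mulr0.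
  have [bY|/f0->] := boolP (b \in Y); last by rewrite !mulr0.
  by rewrite (negbTE (independentP _ _ indY _ _ aY bY)) mul0r.
have s0 : \sum_i f i * f i = 0.
  apply/eqP; rewrite eq_le sumr_ge0 ?andbT => [|j _]; last by rewrite -expr2 sqr_ge0.
  by move: pf; rewrite /pform e0 subr0 pmulr_rle0.
have /eqP : f i * f i = 0.
  by apply: (psumr_eq0P _ s0) => // j _; rewrite -expr2 sqr_ge0.
by rewrite mulf_eq0 orbb => /eqP.
Qed.

Variable A : {set T}.
Hypotheses (indA : independent e A) (cA : (29 <= #|A|)%N).
Hypothesis half_nbr : forall u, (2 * #|nbr e u A| <= #|A|)%N.
Hypothesis maxA : forall x (D : {set T}), independent e D ->
  {in D, forall y, e x y} -> (#|D| < #|A|)%N.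
Hypothesis no_K5 : forall P Q : {set T}, clique e P -> clique e Q ->
  [disjoint P & Q] -> {in P & Q, forall p q, ~~ e p q} -> (#|P| + #|Q| <= 4)%N.
Hypothesis cT : (277 <= #|T|)%N.

(** In [star_bound] for the [k] neighbours and [s] others in [A], one has [k <= s] and
    [k + s >= 29], so [k >= 6] makes the product exceed 36. *)
Lemma nbr_le5 u : (#|nbr e u A| <= 5)%N.
Proof.
set N := nbr e u A; have NA : N \subset A := nbr_sub e u A.
have [uA|uA] := boolP (u \in A).
  rewrite eq_card0 // => t; rewrite mem_nbr; apply/negP => /andP[tA].
  exact/negP/(independentP _ _ indA).
have indNO : independent e (N :|: (A :\: N)).
  by apply: independentS indA; rewrite subUset NA subsetDl.
have uO : u \notin A :\: N by rewrite inE negb_and uA orbT.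
have uN : {in N, forall y, e u y} by move=> y; rewrite mem_nbr => /andP[].
have uO' : {in A :\: N, forall y, ~~ e u y}.
  by move=> y; rewrite in_setD mem_nbr => /andP[+ yA]; rewrite yA.
have := star_bound e_sym e_irr psd uO indNO (disjointDr N A) uN uO'.
have := cardsID N A; rewrite (setIidPr NA).
have := half_nbr u; rewrite -/N.
move: cA; set m := #|A|; set k := #|N|; set s := #|A :\: N| => m29 k2 ks H.
rewrite leqNgt; apply/negP => k6.
have s_k : (k <= s)%N by move: k2; rewrite -ks mulSn mul1n leq_add2l.
have ks29 : 29 <= k%:R + s%:R :> R by rewrite -natrD ler_nat ks.
have k6' : 6 <= k%:R :> R by rewrite ler_nat.
have sk' : k%:R <= s%:R :> R by rewrite ler_nat.
suff: 0 < 0 :> R by rewrite ltxx.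
have [s23|s22] := leqP 23 s.
  have s23' : 23 <= s%:R :> R by rewrite ler_nat.
  have : 0 <= (k%:R - 6) * (s%:R - 23) :> R by rewrite mulr_ge0 ?subr_ge0.
  by lra.
have s22' : s%:R <= 22 :> R by rewrite ler_nat.
have h1 : 0 <= (s%:R - 14) * (22 - s%:R) :> R by apply: mulr_ge0; lra.
have h2 : 0 <= (k%:R + s%:R - 29) * (s%:R - 4) :> R by apply: mulr_ge0; lra.
by lra.
Qed.

(** The refuted bound is the integral form of [#|Y| < 2n/3 + 1]. *)
Lemma no_small_posdef : ~ (forall Y, posdef R e Y -> (3 * #|Y| <= 2 * #|T| + 2)%N).
Proof.
move=> small.
have [/existsP[x /existsP[y /existsP[z /and3P[xy xz yz]]]]|noT] :=
  boolP [exists x, exists y, exists z, [&& e x y, e x z & e y z]].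
  have [Y indY cY] := triangle_far e_sym e_irr psd indA cA nbr_le5 no_K5 xy xz yz.
  have := small Y (independent_posdef indY); have := cardsC Y.
  by move: cT cY; set a := #|T|; set b := #|Y|; set c := #|~: Y|; lia.
have tf x y z : e x y -> e x z -> ~~ e y z.
  move=> xy xz; apply: contra noT => yz; apply/existsP; exists x.
  by apply/existsP; exists y; apply/existsP; exists z; rewrite xy xz.
have deg32 v : (#|nbr e v setT| <= 32)%N.
  rewrite leqNgt; apply/negP => v33.
  (* Without triangles the 33 neighbours are independent, so [maxA] enlarges [A]. *)
  have cA34 : (34 <= #|A|)%N.
    apply: leq_ltn_trans v33 _; apply: (@maxA v); first exact: nbr_independent.
    by move=> y; rewrite mem_nbr => /andP[].
  move: v33; apply/negP; rewrite -leqNgt.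
  have [vA|vA] := boolP (v \in A).
    exact: (degree_in e_sym e_irr psd tf indA nbr_le5 vA cA34).
  exact: (degree_notin e_sym e_irr psd tf indA nbr_le5 vA cA34).
have deg4 v : (#|nbr e v setT| <= 4)%N by apply: (degree_le4 e_sym e_irr tf _ psd).
have local_psd (f : T -> R) : (forall i, 0 <= f i) ->
    (#|[set i | f i != 0%R]| <= 15)%N -> 0 <= pform e f f.
  move=> f0 supp; rewrite leNgt; apply/negP => pf.
  pose P := [set i | f i != 0].
  have pdZ : posdef R e (~: closed_nbr e P).
    by apply: (far_closed_nbr e_sym psd f0 pf) => i; rewrite inE negbK => /eqP.
  (* At most 15 vertices and [15 * 4] neighbours. *)
  have cP : (#|closed_nbr e P| <= 75)%N.
    apply: leq_trans (leq_card_setU _ _) _.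
    apply: leq_trans (leq_add (leqnn _) (card_bigcup_nbr P deg4)) _.
    by move: supp; rewrite -/P; set a := #|P|; lia.
  have := small _ pdZ; have := cardsC (closed_nbr e P).
  by move: cT cP; set a := #|T|; set b := #|~: _|; set c := #|closed_nbr e P|; lia.
have [Y [_ cY pdY]] := large_posdef e_sym e_irr tf local_psd setT.
have := small Y pdY; move: cT cY; rewrite cardsT.
by set a := #|T|; set b := #|Y|; lia.
Qed.

End Core.

(** * Clique and independence numbers as maxima *)

Section Numbers.
Variables (T : finType) (e : rel T).

Lemma leq_clique_number (A : {set T}) : clique e A -> (#|A| <= clique_number e)%N.
Proof. by move=> clA; apply: leq_bigmax_cond. Qed.

Lemma leq_independence_number (A : {set T}) :
  independent e A -> (#|A| <= independence_number e)%N.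
Proof. by move=> indA; apply: leq_bigmax_cond. Qed.

Lemma independence_numberP :
  exists2 A : {set T}, independent e A & #|A| = independence_number e.
Proof.
have ind0 : independent e set0 by apply/independentP => x y; rewrite inE.
have [|A indA cA] := @eq_bigmax_cond _ (independent e) (fun A : {set T} => #|A|).
  by apply/card_gt0P; exists set0.
by exists A => //; rewrite /independence_number cA.
Qed.

End Numbers.

(** * Choice of signs, and transfer between the switching graph and [S] *)

Section Switching.
Variables (R : realType) (n : nat) (S : 'M[R]_n).
Hypothesis S_seidel : seidel S.

(* [signed i true] stands for the vector opposite to that of [signed i false]. *)
Definition signed (i : 'I_n) (b : bool) : 'I_(n + n) :=
  if b then rshift n i else lshift n i.

Local Notation G := (switching_graph S).

Lemma signed_inj i j b c : signed i b = signed j c -> i = j /\ b = c.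
Proof.
case: b; case: c => /eqP; rewrite ?eq_lshift ?eq_rshift ?eq_lrshift ?eq_rlshift //;
  by move/eqP.
Qed.

Lemma signedP x : exists i b, x = signed i b.
Proof.
rewrite -(splitK x); case: (split x) => i; first by exists i, false.
by exists i, true.
Qed.

Let neq1 : (1 == -1 :> R) = false.
Proof. by apply/negbTE; rewrite -subr_eq0 opprK -[1 + 1]/(2%:R) pnatr_eq0. Qed.

Lemma switching_graph_neq i j b c : i != j ->
  G (signed i b) (signed j c) = (S i j == - (-1) ^+ (b (+) c)).
Proof.
move=> ij; rewrite /switching_graph /seidel_graph /switching_mx.
case: b; case: c; rewrite ?block_mxEul ?block_mxEur ?block_mxEdl ?block_mxEdr //=.
- by rewrite !mxE (negbTE ij) addr0 expr1 opprK eqr_oppLR opprK.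
- by rewrite !mxE (negbTE ij) addr0 expr1 opprK eqr_oppLR opprK.
Qed.

Lemma switching_graphN i j b c : i != j ->
  G (signed i (~~ b)) (signed j c) = ~~ G (signed i b) (signed j c).
Proof.
move=> ij; rewrite !switching_graph_neq //; have [_ _ S1] := S_seidel.
by case: (S1 i j ij) => ->; case: b; case: c;
  rewrite /= ?expr0 ?expr1 ?opprK ?eqxx ?neq1 // eq_sym neq1.
Qed.

Lemma switching_graph_sym : symmetric G.
Proof. exact: seidel_graph_sym (switching_mx_seidel S_seidel). Qed.

Lemma switching_graph_irr : irreflexive G.
Proof. exact: seidel_graph_irr (switching_mx_seidel S_seidel). Qed.

Section Signs.
Variable s : 'I_n -> bool.

(** The graph of [S] switched at the indices where [s] is true, as an induced subgraph of the
    switching graph. *)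
Definition signed_graph : rel 'I_n := fun i j => G (signed i (s i)) (signed j (s j)).
Local Notation e := signed_graph.

Lemma signed_graph_sym : symmetric e.
Proof. by move=> i j; apply: switching_graph_sym. Qed.

Lemma signed_graph_irr : irreflexive e.
Proof. by move=> i; apply: switching_graph_irr. Qed.

Definition signed_set (P Q : {set 'I_n}) : {set 'I_(n + n)} :=
  [set signed i (s i) | i in P] :|: [set signed i (~~ s i) | i in Q].

Lemma card_signed_set P Q : #|signed_set P Q| = (#|P| + #|Q|)%N.
Proof.
rewrite cardsU !card_imset => [|i j /signed_inj[]//|i j /signed_inj[]//].
rewrite disjoint_setI0 ?cards0 ?subn0 //; apply/pred0P => x /=.
by apply/negP => /andP[/imsetP[i _ ->] /imsetP[j _ /signed_inj[->]]]; case: (s j).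
Qed.

Lemma signed_graphNN i j :
  G (signed i (~~ s i)) (signed j (~~ s j)) = e i j.
Proof.
have [->|ij] := eqVneq i j; first by rewrite switching_graph_irr signed_graph_irr.
rewrite /signed_graph switching_graphN // switching_graph_sym switching_graphN 1?eq_sym //.
by rewrite negbK switching_graph_sym.
Qed.

Lemma signed_graphN i j : i != j -> G (signed i (s i)) (signed j (~~ s j)) = ~~ e i j.
Proof.
by move=> ij; rewrite switching_graph_sym switching_graphN 1?eq_sym // switching_graph_sym.
Qed.

(** Taking opposite signs on [Q] turns the non-edges to [P] into edges and keeps the edges inside
    [Q]. *)
Lemma clique_bound P Q : clique e P -> clique e Q -> [disjoint P & Q] ->
  {in P & Q, forall p q, ~~ e p q} -> (#|P| + #|Q| <= switching_omega S)%N.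
Proof.
move=> clP clQ dPQ ePQ; rewrite -card_signed_set; apply: leq_clique_number.
apply/cliqueP => x y /setUP[]/imsetP[i iX ->] /setUP[]/imsetP[j jY ->] xy.
- by apply: (cliqueP _ _ clP) => //; apply: contraNneq xy => ->.
- by rewrite signed_graphN ?ePQ //; apply: contraTneq iX => ->; rewrite (disjointFl dPQ).
- rewrite switching_graph_sym signed_graphN ?ePQ //.
  by apply: contraTneq jY => ->; rewrite (disjointFl dPQ).
- by rewrite signed_graphNN; apply: (cliqueP _ _ clQ) => //; apply: contraNneq xy => ->.
Qed.

(** The opposite of [x] is joined to no vertex of [D] and can be added to it. *)
Lemma independent_bound x D : independent e D -> {in D, forall y, e x y} ->
  (#|D| < switching_alpha S)%N.
Proof.
move=> indD xD; rewrite -addn1 -(cards1 x) -card_signed_set.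
apply: leq_independence_number; apply/independentP => a b.
have Dx y : y \in D -> y != x by move=> /xD; apply: contraTneq => ->; rewrite signed_graph_irr.
move=> /setUP[]/imsetP[i iX ->] /setUP[]/imsetP[j jY ->].
- exact: (independentP _ _ indD).
- by move: jY => /set1P->; rewrite signed_graphN ?Dx // negbK signed_graph_sym xD.
- move: iX => /set1P->.
  by rewrite switching_graph_sym signed_graphN ?Dx // negbK signed_graph_sym xD.
- by rewrite signed_graphNN; move: iX jY => /set1P-> /set1P->; rewrite signed_graph_irr.
Qed.

(** Off the diagonal, the entries of the switched matrix are [1 - 2e], so [S + 5I] becomes
    [4I - 2E + J]. *)
Lemma qform_signed (f : 'I_n -> R) (u : 'rV[R]_n) :
  (forall i, u 0 i = (-1) ^+ s i * f i) ->
  qform e f f = (u *m (S + 5%:R%:M) *m u^T) 0 0.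
Proof.
move=> uE; have ss i : (-1) ^+ s i * (-1) ^+ s i = 1 :> R by rewrite -expr2 sqrr_sign.
have entry i j : (u 0 i * (S + 5%:R%:M) i j) * u 0 j =
    4 * ((i == j)%:R * (f i * f j)) - 2 * ((e i j)%:R * (f i * f j)) + f i * f j.
  rewrite !uE !mxE; have [<-|ij] := eqVneq i j.
    have [_ -> _] := S_seidel; rewrite signed_graph_irr /=.
    transitivity (5 * ((-1) ^+ s i * (-1) ^+ s i) * (f i * f i)); first by ring.
    by rewrite ss; ring.
  rewrite /signed_graph switching_graph_neq // mulr0n addr0.
  have [_ _ S1] := S_seidel.
  by case: (S1 i j ij) => ->; case: (s i); case: (s j);
    rewrite /= ?expr0 ?expr1 ?opprK ?eqxx ?neq1 1?eq_sym ?neq1 /=; ring.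
have -> : (u *m (S + 5%:R%:M) *m u^T) 0 0
    = \sum_i \sum_j u 0 i * (S + 5%:R%:M) i j * u 0 j.
  rewrite mxE [RHS]exchange_big; apply: eq_bigr => j _ /=.
  by rewrite [u^T j 0]mxE [(u *m _) 0 j]mxE mulr_suml.
under eq_bigr do under eq_bigr do rewrite entry.
rewrite /qform /pform mulr_suml.
under [X in _ = X]eq_bigr do rewrite big_split sumrB /= -!mulr_sumr.
rewrite big_split sumrB /= -!mulr_sumr.
have -> : \sum_i \sum_j (i == j)%:R * (f i * f j) = \sum_i f i * f i.
  apply: eq_bigr => i _; rewrite (bigD1 i) //= eqxx mul1r big1 ?addr0 // => j.
  by rewrite eq_sym => /negbTE->; rewrite mul0r.
by rewrite -mulr_suml; ring.
Qed.

(** Were the rank smaller, a nonzero vector supported on [Y] would lie in the kernel of [S + 5I];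
    there [2I - E] is nonpositive, since [J] is semidefinite. *)
Lemma posdef_card_rank (Y : {set 'I_n}) : posdef R e Y -> (#|Y| <= \rank (S + 5%:R%:M)%R)%N.
Proof.
move=> pdY; rewrite leqNgt; apply/negP => lt_rank.
pose M := S + 5%:R%:M; pose P : 'M[R]_(#|Y|, n) := rowsub enum_val 1%:M.
have ker0 : kermx (P *m M) != 0.
  rewrite kermx_eq0 /row_free; apply: contraL lt_rank => /eqP rPM.
  by rewrite -leqNgt -[X in (X <= _)%N]rPM mxrankM_maxr.
have /rowV0Pn[v /sub_kermxP vPM v0] := ker0.
pose f i := (-1) ^+ s i * (v *m P) 0 i.
have uE i : (v *m P) 0 i = (-1) ^+ s i * f i by rewrite /f mulrA -expr2 sqrr_sign mul1r.
have vP k : (v *m P) 0 (enum_val k) = v 0 k.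
  rewrite mxE (bigD1 k) //= !mxE eqxx mulr1 big1 ?addr0 // => j jk.
  by rewrite !mxE (inj_eq enum_val_inj) (negbTE jk) mulr0.
have f0 : forall i, f i = 0.
  apply: pdY => [i iY|].
    rewrite /f mxE big1 ?mulr0 // => k _; rewrite !mxE; case: eqP => [kE|_]; last by rewrite mulr0.
    by rewrite -kE enum_valP in iY.
  have : qform e f f = 0.
    by rewrite (qform_signed uE) -/M -[v *m P *m M]mulmxA vPM mul0mx mxE.
  rewrite /qform -expr2 => q0; have := sqr_ge0 (\sum_i f i); lra.
by move: v0; apply/negP; rewrite negbK; apply/eqP/rowP => k; rewrite -vP uE f0 mulr0 mxE.
Qed.

Lemma signed_psd : is_lambda_min S (- 5%:R) -> forall f : 'I_n -> R, 0 <= qform e f f.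
Proof.
move=> [_ min5] f; pose u := \row_i ((-1) ^+ s i * f i).
rewrite (@qform_signed f u) => [|i]; last by rewrite mxE.
have [symS _ _] := S_seidel; have := rayleigh_ge u symS min5.
have -> : (u *m (S + 5%:R%:M) *m u^T) 0 0
    = (u *m S *m u^T) 0 0 + 5 * (u *m u^T) 0 0.
  by rewrite mulmxDr mulmxDl mul_mx_scalar -scalemxAl [LHS]mxE [X in _ + X]mxE.
by set a := (u *m S *m u^T) 0 0; set b := (u *m u^T) 0 0; lra.
Qed.
End Signs.

Lemma majority_signs : (29 <= switching_alpha S)%N -> exists s (A : {set 'I_n}),
  [/\ independent (signed_graph s) A, #|A| = switching_alpha S
    & forall i, (2 * #|nbr (signed_graph s) i A| <= #|A|)%N].
Proof.
move=> cS; have [B indB cB] := independence_numberP G.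
(* Any third vertex of [B] would be joined to exactly one of two opposite vertices. *)
have B2 i : ~~ ((signed i true \in B) && (signed i false \in B)).
  apply/negP => /andP[iB1 iB0].
  have [x /setDP[xB]] : exists x, x \in B :\: [set signed i true; signed i false].
    apply/set0Pn; rewrite -card_gt0; have := cardsID [set signed i true; signed i false] B.
    have := subset_leq_card (subsetIr B [set signed i true; signed i false]).
    rewrite cards2; move: cS; rewrite /switching_alpha -cB.
    by set a := #|B|; set b := #|_ :&: _|; set c := #|_ :\: _|; case: (_ != _); lia.
  have [j [b xE]] := signedP x; rewrite {}xE in xB *.
  rewrite !inE negb_or => /andP[j1 j0].
  have ij : i != j.
    by apply: contraTneq isT => ij; move: j1 j0; rewrite ij; case: b {xB}; rewrite ?eqxx.
  have := switching_graphN true b ij; rewrite /= (negbTE (independentP _ _ indB _ _ iB1 xB)).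
  by rewrite (negbTE (independentP _ _ indB _ _ iB0 xB)).
pose s0 i := signed i true \in B; pose A := [set i | signed i (s0 i) \in B].
(* Outside [A], changing the sign complements the neighbourhood in [A], so it is changed when more
   than half of [A] is adjacent. *)
pose s i := if i \in A then s0 i
  else (#|A| < 2 * #|[set a in A | G (signed i false) (signed a (s0 a))]|)%N.
have sA i : i \in A -> s i = s0 i by rewrite /s => ->.
have indA : independent (signed_graph s) A.
  apply/independentP => i j iA jA; rewrite /signed_graph !sA //.
  by apply: (independentP _ _ indB); [move: iA|move: jA]; rewrite inE.
have cA : #|A| = switching_alpha S.
  rewrite /switching_alpha -cB.
  have -> : B = [set signed i (s0 i) | i in A].
    apply/setP => x; apply/idP/imsetP => [xB|[i + ->]]; last by rewrite inE.
    have [i [b xE]] := signedP x; have bE : s0 i = b.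
      move: (B2 i) xB; rewrite /s0 {}xE; case: b => [_ -> //|+ xB].
      by rewrite xB andbT => /negbTE.
    by exists i; rewrite ?inE bE -?xE.
  by rewrite card_imset // => i j /signed_inj[].
exists s, A; split=> // i.
have [iA|iA] := boolP (i \in A).
  rewrite eq_card0 // => t; rewrite mem_nbr; apply/negP => /andP[tA].
  exact/negP/(independentP _ _ indA).
pose N b := [set a in A | G (signed i b) (signed a (s0 a))].
have -> : nbr (signed_graph s) i A = N (s i).
  apply/setP => t; rewrite mem_nbr /N [in RHS]inE /signed_graph.
  by case: (boolP (t \in A)) => //= /sA->.
have NT : N true = A :\: N false.
  apply/setP => t; rewrite in_setD /N [in LHS]inE [in RHS]inE.
  case: (boolP (t \in A)) => tA //=.
  rewrite ?andbT -(switching_graphN false) //.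
  by apply: contraNneq iA => ->.
have NF : N false \subset A by apply/subsetP => t; rewrite inE => /andP[].
rewrite /s (negbTE iA) -/(N false); case: ltnP => [lt_N|//].
rewrite NT; have := cardsID (N false) A; rewrite (setIidPr NF).
by move: lt_N; set a := #|A|; set b := #|N false|; set c := #|_ :\: _|; lia.
Qed.

End Switching.

Theorem theorem7p3 (R : realType) (n : nat) (S : 'M[R]_n)
    (n_ge : (277 <= n)%N)
    (S_seidel : seidel S)
    (S_min : is_lambda_min S (- 5%:R))
    (S_omega : switching_omega S = 4%N)
    (S_alpha : (29 <= switching_alpha S)%N) :
  (2 * n)%:R / 3%:R + 1 <= (\rank (S + 5%:R%:M)%R)%:R :> R.
Proof.
have [s [A [indA cA half]]] := majority_signs S_seidel S_alpha.
rewrite leNgt; apply/negP => lt_rank.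
(* By integrality, [3 rank < 2n + 3] becomes [3 rank <= 2n + 2]. *)
have lt_rank_nat : (3 * \rank (S + 5%:R%:M)%R <= 2 * n + 2)%N.
  rewrite -ltnS -(ltr_nat R) -addnS natrD natrM.
  by move: lt_rank; set r : R := (\rank _)%:R; set q : R := (2 * n)%:R; lra.
apply: (no_small_posdef (signed_graph_sym S_seidel s) (signed_graph_irr S_seidel s)
  (signed_psd S_seidel s S_min) indA _ half) => [|x D indD xD|P Q clP clQ dPQ ePQ||Y pdY].
- by rewrite cA.
- by rewrite cA; apply: independent_bound xD.
- by rewrite -S_omega; apply: clique_bound ePQ.
- by rewrite card_ord.
- rewrite card_ord; apply: leq_trans lt_rank_nat; rewrite leq_mul2l.
  exact: posdef_card_rank pdY.
Qed.
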